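(* Suppose that $$(p-1)\sum_{\xi\in\Omega_p}\{\lambda(0,\xi)+\lambda(1,\xi)\}<A+B.$$ Then the limit $$\alpha:=\lim_{N\to\infty}\rho_N(1)$$ exists, and it does not depend on the boundary conditions at $N-1$. Moreover, for any continuous function $G:[0,1]\to\mathbb{R}$, $$\lim_{N\to\infty}E_{\mu_N}\Big[\,\Big|\frac1N\sum_{k=1}^{N-1}G(k/N)\,[\eta_k-\bar u(k/N)]\,\Big|\,\Big]=0,$$ where $\bar u$ is the unique solution of the linear equation $0=\Delta u$, $u(0)=\alpha$, $u(1)=\beta$ on $[0,1]$.
   Context: Fix an integer $p\ge1$, $\beta\in(0,1)$ and a non-negative function $c:\{0,1\}^p\to\mathbb{R}_+$. For $N>p$, $N\ge2$, let $\Lambda_N=\{1,\dots,N-1\}$ and $\Omega_N=\{0,1\}^{\Lambda_N}$; in the same notation $\Omega_p=\{0,1\}^{\{1,\dots,p-1\}}$. For $\eta\in\Omega_N$, $\sigma^{k,k+1}\eta$ is the configuration obtained from $\eta$ by exchanging $\eta_k$ and $\eta_{k+1}$, and $\sigma^k\eta$ is the one obtained by replacing $\eta_k$ by $1-\eta_k$. Let $L_N=L_l+L_{b,N}+L_{r,N}$ be the generator on functions $f:\Omega_N\to\mathbb{R}$ with $$(L_lf)(\eta)=c(\eta_1,\dots,\eta_p)\,[f(\sigma^1\eta)-f(\eta)],\qquad (L_{b,N}f)(\eta)=\sum_{k=1}^{N-2}\{f(\sigma^{k,k+1}\eta)-f(\eta)\},$$ $$(L_{r,N}f)(\eta)=\{\beta(1-\eta_{N-1})+(1-\beta)\eta_{N-1}\}\,\{f(\sigma^{N-1}\eta)-f(\eta)\}.$$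 Let $A=\min_{\xi\in\Omega_p}c(0,\xi)$ and $B=\min_{\xi\in\Omega_p}c(1,\xi)$ be the minimal creation and annihilation rates, and set $\lambda(0,\xi)=c(0,\xi)-A$, $\lambda(1,\xi)=c(1,\xi)-B$ for $\xi\in\Omega_p$. The Markov chain with generator $L_N$ has a unique stationary state, denoted by $\mu_N$, with expectation $E_{\mu_N}$; and $\rho_N(k)=E_{\mu_N}[\eta_k]$ for $k\in\Lambda_N$. *)

(* Defs.v *)
From HB Require Import structures.
From mathcomp Require Import all_boot all_order all_algebra.
From mathcomp Require Import all_classical all_reals all_analysis.
Set Implicit Arguments.
Unset Strict Implicit.
Unset Printing Implicit Defensive.
Import Order.TTheory GRing.Theory Num.Theory.
Import numFieldNormedType.Exports.
Local Open Scope classical_set_scope.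
Local Open Scope ring_scope.

(* {0,1}^n; site k in {1, ..., n} is the ordinal k - 1. *)
Definition config (n : nat) := {ffun 'I_n -> bool}.

(* Omega N = {0,1}^{1, ..., N-1}. *)
Definition Omega (N : nat) := config N.-1.

(* eta_k, with k numbered from 1; false when k is not a site. *)
Definition occ (n : nat) (eta : config n) (k : nat) : bool :=
  [exists i : 'I_n, (i.+1 == k) && eta i].

Definition flip (n : nat) (k : nat) (eta : config n) : config n :=
  [ffun i : 'I_n => if i.+1 == k then ~~ eta i else eta i].

Definition exch (n : nat) (k : nat) (eta : config n) : config n :=
  [ffun i : 'I_n => if i.+1 == k then occ eta k.+1
                    else if i.+1 == k.+1 then occ eta k else eta i].

(* (eta_1, ..., eta_p) *)
Definition window (p n : nat) (eta : config n) : config p :=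
  [ffun i : 'I_p => occ eta i.+1].

(* (a, xi) = (a, xi_1, ..., xi_(p-1)); the coordinate numbered i.+1 of (a, xi)
   is xi_i when i > 0. *)
Definition bcons (p : nat) (a : bool) (xi : Omega p) : config p :=
  [ffun i : 'I_p => if i == 0%N :> nat then a else occ xi i].

Definition left_gen (R : realType) (p : nat) (c : config p -> R) (N : nat)
    (f : Omega N -> R) (eta : Omega N) : R :=
  c (window p eta) * (f (flip 1 eta) - f eta).

Definition bulk_gen (R : realType) (N : nat)
    (f : Omega N -> R) (eta : Omega N) : R :=
  \sum_(1 <= k < N.-1) (f (exch k eta) - f eta).

Definition right_gen (R : realType) (beta : R) (N : nat)
    (f : Omega N -> R) (eta : Omega N) : R :=
  (beta * (1 - (occ eta N.-1)%:R) + (1 - beta) * (occ eta N.-1)%:R)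
  * (f (flip N.-1 eta) - f eta).

Definition gen (R : realType) (p : nat) (c : config p -> R) (beta : R)
    (N : nat) (f : Omega N -> R) (eta : Omega N) : R :=
  left_gen c f eta + bulk_gen f eta + right_gen beta f eta.

Definition expect (R : realType) (T : finType) (mu : {ffun T -> R})
    (X : T -> R) : R := \sum_(x : T) mu x * X x.

Definition is_distr (R : realType) (T : finType) (mu : {ffun T -> R}) : Prop :=
  (forall x, 0 <= mu x) /\ \sum_x mu x = 1.

Definition stationary (R : realType) (p : nat) (c : config p -> R) (beta : R)
    (N : nat) (mu : {ffun Omega N -> R}) : Prop :=
  is_distr mu /\ forall f : Omega N -> R, expect mu (gen c beta f) = 0.

(* By stationary_stat_state and stationary_unique below, this is the unique
   stationary state as soon as c >= 0 and 0 < beta < 1; the default value 0 of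
   xget is never used then. *)
Definition stat_state (R : realType) (p : nat) (c : config p -> R) (beta : R)
    (N : nat) : {ffun Omega N -> R} :=
  xget [ffun=> 0] [set mu | stationary c beta mu].

Definition rho (R : realType) (p : nat) (c : config p -> R) (beta : R)
    (N k : nat) : R :=
  expect (stat_state c beta N) (fun eta => (occ eta k)%:R).

(* min over xi in Omega_p of c(a, xi): A for a = false, B for a = true. The
   base value is itself one of the values, so this is the minimum. *)
Definition min_rate (R : realType) (p : nat) (c : config p -> R) (a : bool) : R :=
  \big[Num.min/c (bcons a [ffun=> false])]_(xi : Omega p) c (bcons a xi).

Definition lambda (R : realType) (p : nat) (c : config p -> R) (a : bool)
    (xi : Omega p) : R :=
  c (bcons a xi) - min_rate c a.

Definition laplace_solution (R : realType) (a b : R) (u : R -> R) : Prop :=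
  [/\ {within `[0, 1], continuous u},
      forall x : R, 0 < x < 1 -> derivable u x 1,
      forall x : R, 0 < x < 1 -> derivable (derive1 u) x 1 /\ derive1n 2 u x = 0,
      u 0 = a & u 1 = b].

(* (1/N) sum_k G(k/N) [eta_k - u(k/N)] *)
Definition empirical_gap (R : realType) (G u : R -> R) (N : nat)
    (eta : Omega N) : R :=
  N%:R^-1 * \sum_(1 <= k < N)
    G (k%:R / N%:R) * ((occ eta k)%:R - u (k%:R / N%:R)).

Lemma occE (n : nat) (eta : config n) (i : 'I_n) : occ eta i.+1 = eta i.
Proof.
apply/existsP/idP => [[j /andP[/eqP[/val_inj ->]]]//|h].
by exists i; rewrite eqxx.
Qed.

Lemma occ_out (n : nat) (eta : config n) (k : nat) :
  (n < k)%N -> occ eta k = false.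
Proof.
move=> nk; apply/negbTE/existsPn => i; apply/negP => /andP[/eqP ik _].
by move: (ltn_ord i); rewrite ik leqNgt nk.
Qed.

Lemma flipK (n k : nat) : involutive (@flip n k).
Proof.
by move=> eta; apply/ffunP => i; rewrite !ffunE; case: eqP => // _; rewrite negbK.
Qed.

Lemma occ_flip (n k j : nat) (eta : config n) : (0 < j <= n)%N ->
  occ (flip k eta) j = if j == k then ~~ occ eta j else occ eta j.
Proof.
case: j => // j /= jn; by rewrite (occE _ (Ordinal jn)) (occE eta (Ordinal jn)) ffunE.
Qed.

Lemma occ_exch (n k j : nat) (eta : config n) : (0 < j <= n)%N ->
  occ (exch k eta) j = if j == k then occ eta k.+1
                       else if j == k.+1 then occ eta k else occ eta j.
Proof.
case: j => // j /= jn; by rewrite (occE _ (Ordinal jn)) (occE eta (Ordinal jn)) ffunE.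
Qed.

Lemma occ_inj (n : nat) (eta xi : config n) :
  (forall j, (0 < j <= n)%N -> occ eta j = occ xi j) -> eta = xi.
Proof. by move=> h; apply/ffunP => i; rewrite -!occE h //=. Qed.

Lemma exchK (n k : nat) (eta : config n) : (0 < k < n)%N ->
  exch k (exch k eta) = eta.
Proof.
move=> /andP[k0 kn]; apply: occ_inj => j jn.
rewrite !occ_exch ?k0 ?ltnS ?(ltnW kn) //= eqxx.
rewrite (_ : (k.+1 == k) = false); last by rewrite gtn_eqF.
by rewrite eqxx; case: eqP => [->//|_]; case: eqP => [->|].
Qed.

Lemma flip_conj (n k : nat) (eta : config n) : (0 < k < n)%N ->
  exch k (flip k.+1 (exch k eta)) = flip k eta.
Proof.
move=> /andP[k0 kn]; apply: occ_inj => j jn.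
have E : (k.+1 == k) = false by rewrite gtn_eqF.
have E' : (k == k.+1) = false by rewrite ltn_eqF.
do ![rewrite (occ_exch, occ_flip) ?k0 ?ltnS ?(ltnW kn) //= ?eqxx ?E ?E'].
by case: eqP => [->|_]; [|case: eqP => [->|]].
Qed.

Lemma flip_closed (n : nat) (P : config n -> Prop) :
  (forall k eta, (0 < k < n)%N -> P eta -> P (exch k eta)) ->
  (forall eta, P eta -> P (flip n eta)) ->
  forall d eta, (d < n)%N -> P eta -> P (flip (n - d) eta).
Proof.
move=> Pe Pf; elim=> [|d IH] eta dn Pn; first by rewrite subn0; exact: Pf.
have kn : (0 < n - d.+1 < n)%N.
  by rewrite subn_gt0 dn /= ltn_subrL /=; exact: leq_ltn_trans dn.
rewrite -(flip_conj eta kn); apply: (Pe) => //; rewrite (subnSK (ltnW dn)).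
apply: (IH _ (ltnW dn)); exact: Pe kn Pn.
Qed.

(* A nonempty set of configurations invariant under the right flip and the
   exchanges contains every configuration. *)
Lemma connected (n : nat) (P : config n -> Prop) :
  (forall k eta, (0 < k < n)%N -> P eta -> P (exch k eta)) ->
  (forall eta, P eta -> P (flip n eta)) ->
  forall eta xi, P eta -> P xi.
Proof.
move=> Pe Pf.
have Pk k eta : (0 < k <= n)%N -> P eta -> P (flip k eta).
  move=> /andP[k0 kn] Pn; rewrite -(subKn kn); apply: flip_closed => //.
  by rewrite ltn_subrL k0 (leq_trans k0 kn).
move=> eta xi Pn.
suff : forall m, exists z, P z /\
    forall j, (0 < j <= n)%N -> (j <= m)%N -> occ z j = occ xi j.
  move=> /(_ n)[z [Pz h]]; suff <- : z = xi by [].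
  by apply: occ_inj => j jn; apply: h => //; case/andP: jn.
elim=> [|m [z [Pz h]]].
  by exists eta; split => // j /andP[j0 _]; rewrite leqNgt j0.
have [mn|nm] := ltnP m n; last first.
  exists z; split => // j jn jm; apply: h => //.
  by case/andP: jn => _ jn; exact: leq_trans jn nm.
have [e|ne] := eqVneq (occ z m.+1) (occ xi m.+1).
  exists z; split => // j jn; rewrite leq_eqVlt => /predU1P[->//|]; exact: h.
exists (flip m.+1 z); split; first exact: Pk.
move=> j jn jm; rewrite occ_flip //; case: eqP => [->|/eqP jne].
  by move: ne; case: (occ z _); case: (occ xi _).
by apply: h => //; rewrite -ltnS ltn_neqAle jne.
Qed.

Definition qmat (R : realType) (p : nat) (c : config p -> R) (beta : R)
    (N : nat) (x y : Omega N) : R := gen c beta (fun z => (z == y)%:R) x.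

Lemma gen_qmat (R : realType) (p : nat) (c : config p -> R) (beta : R)
    (N : nat) (f : Omega N -> R) (x : Omega N) :
  gen c beta f x = \sum_y qmat c beta x y * f y.
Proof.
have E z : f z = \sum_y (z == y)%:R * f y.
  rewrite (bigD1 z) //= eqxx mul1r big1 ?addr0 // => y yz.
  by rewrite eq_sym (negbTE yz) mul0r.
have D z : f z - f x = \sum_y ((z == y)%:R - (x == y)%:R) * f y.
  by rewrite (E z) (E x) -sumrB; apply: eq_bigr => y _; rewrite mulrBl.
rewrite /gen /left_gen /bulk_gen /right_gen !D !mulr_sumr.
under [X in _ + X + _]eq_bigr do rewrite D.
rewrite [X in _ + X + _]exchange_big /= -!big_split /=; apply: eq_bigr => y _.
rewrite /qmat /gen /left_gen /bulk_gen /right_gen 2![in RHS]mulrDl mulr_suml.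
by congr (_ + _ + _); rewrite mulrA.
Qed.

Lemma qmat_row (R : realType) (p : nat) (c : config p -> R) (beta : R)
    (N : nat) (x : Omega N) : \sum_y qmat c beta x y = 0.
Proof.
transitivity (gen c beta (fun=> 1) x).
  by rewrite gen_qmat; apply: eq_bigr => y _; rewrite mulr1.
rewrite /gen /left_gen /bulk_gen /right_gen subrr !mulr0 big1 ?addr0 //.
Qed.

Lemma right_rate_gt0 (R : realType) (beta : R) (b : bool) : 0 < beta < 1 ->
  0 < beta * (1 - b%:R) + (1 - beta) * b%:R.
Proof.
move=> /andP[b0 b1]; case: b; rewrite ?subrr ?subr0 ?mulr0 ?mulr1 ?add0r ?addr0 //.
by rewrite subr_gt0.
Qed.

Lemma qmat_ge0 (R : realType) (p : nat) (c : config p -> R) (beta : R)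
    (N : nat) (x y : Omega N) : (forall xi, 0 <= c xi) -> 0 < beta < 1 ->
  x != y -> 0 <= qmat c beta x y.
Proof.
move=> c0 hb xy; rewrite /qmat /gen /left_gen /bulk_gen /right_gen (negbTE xy).
rewrite !subr0 !addr_ge0 ?mulr_ge0 ?c0 ?ler0n ?(ltW (right_rate_gt0 _ hb)) //.
by apply: sumr_ge0 => k _; rewrite subr0 ler0n.
Qed.

Lemma qmat_exch_gt0 (R : realType) (p : nat) (c : config p -> R) (beta : R)
    (N : nat) (k : nat) (y : Omega N) : (forall xi, 0 <= c xi) ->
  0 < beta < 1 -> (0 < k < N.-1)%N -> exch k y != y ->
  0 < qmat c beta (exch k y) y.
Proof.
move=> c0 hb kN ne; rewrite /qmat /gen /left_gen /bulk_gen /right_gen (negbTE ne).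
rewrite !subr0 ltr_wpDr ?mulr_ge0 ?ler0n ?(ltW (right_rate_gt0 _ hb)) //.
rewrite ltr_wpDl ?mulr_ge0 ?ler0n //.
rewrite (bigD1_seq k) ?mem_index_iota ?iota_uniq //= exchK // eqxx subr0.
by rewrite ltr_wpDr ?ltr01 //; apply: sumr_ge0 => j _; rewrite subr0 ler0n.
Qed.

Lemma qmat_flip_gt0 (R : realType) (p : nat) (c : config p -> R) (beta : R)
    (N : nat) (y : Omega N) : (forall xi, 0 <= c xi) ->
  0 < beta < 1 -> flip N.-1 y != y -> 0 < qmat c beta (flip N.-1 y) y.
Proof.
move=> c0 hb ne; rewrite /qmat /gen /left_gen /bulk_gen /right_gen (negbTE ne).
rewrite !subr0 ltr_wpDl //.
  rewrite addr_ge0 ?mulr_ge0 ?ler0n //.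
  by apply: sumr_ge0 => j _; rewrite subr0 ler0n.
by rewrite flipK eqxx mulr1; exact: right_rate_gt0.
Qed.

Definition invariant (R : realType) (p : nat) (c : config p -> R) (beta : R)
    (N : nat) (v : Omega N -> R) : Prop :=
  forall y, \sum_x v x * qmat c beta x y = 0.

Lemma invariant_expect (R : realType) (p : nat) (c : config p -> R) (beta : R)
    (N : nat) (mu : {ffun Omega N -> R}) : invariant c beta mu <->
  forall f : Omega N -> R, expect mu (gen c beta f) = 0.
Proof.
split=> [h f|h y]; last exact: h.
rewrite /expect; under eq_bigr do rewrite gen_qmat mulr_sumr.
rewrite exchange_big /= big1 // => y _.
by under eq_bigr do rewrite mulrA; rewrite -mulr_suml h mul0r.
Qed.

Lemma invariant_norm (R : realType) (p : nat) (c : config p -> R) (beta : R)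
    (N : nat) (v : Omega N -> R) : (forall xi, 0 <= c xi) -> 0 < beta < 1 ->
  invariant c beta v -> invariant c beta (fun x => `|v x|).
Proof.
move=> c0 hb hv.
have qd (y : Omega N) : qmat c beta y y <= 0.
  have := qmat_row c beta y; rewrite (bigD1 y) //= => /eqP.
  rewrite addr_eq0 => /eqP ->; rewrite oppr_le0; apply: sumr_ge0 => z zy.
  by apply: qmat_ge0; rewrite // eq_sym.
have ge0 y : 0 <= \sum_x `|v x| * qmat c beta x y.
  have := hv y; rewrite (bigD1 y) //= => /eqP; rewrite addr_eq0 => /eqP e.
  rewrite (bigD1 y) //= addrC -[X in _ + X]opprK subr_ge0.
  rewrite -mulrN -(ler0_norm (qd y)) -normrM e normrN.
  apply: le_trans (ler_norm_sum _ _ _) _; apply: ler_sum => x xy.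
  by rewrite normrM (ger0_norm (qmat_ge0 c0 hb xy)).
have s0 : \sum_y \sum_x `|v x| * qmat c beta x y = 0.
  rewrite exchange_big big1 //= => x _.
  by rewrite -mulr_sumr qmat_row mulr0.
move=> y; move/eqP: s0; rewrite psumr_eq0 => [/allP/(_ y)|z _]; last exact: ge0.
by rewrite mem_index_enum => /(_ isT)/eqP.
Qed.

Lemma invariant_zero (R : realType) (p : nat) (c : config p -> R) (beta : R)
    (N : nat) (v : Omega N -> R) : (forall xi, 0 <= c xi) -> 0 < beta < 1 ->
  invariant c beta v -> (forall x, 0 <= v x) ->
  forall x y, v x = 0 -> v y = 0.
Proof.
move=> c0 hb hv v0.
have step x y : v y = 0 -> x != y -> 0 < qmat c beta x y -> v x = 0.
  move=> vy xy qxy; have := hv y; rewrite (bigD1 y) //= vy mul0r add0r => /eqP.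
  rewrite psumr_eq0 => [/allP/(_ x)|z zy]; last first.
    by rewrite mulr_ge0 ?qmat_ge0.
  rewrite mem_index_enum => /(_ isT); rewrite xy /= mulf_eq0 (gt_eqF qxy) orbF.
  by move/eqP.
apply: connected => [k eta kn ve|eta ve].
  have [->//|ne] := eqVneq (exch k eta) eta.
  by apply: (step _ eta) => //; exact: qmat_exch_gt0.
have [->//|ne] := eqVneq (flip N.-1 eta) eta.
by apply: (step _ eta) => //; exact: qmat_flip_gt0.
Qed.

Lemma stationary_unique (R : realType) (p : nat) (c : config p -> R) (beta : R)
    (N : nat) (mu nu : {ffun Omega N -> R}) :
  (forall xi, 0 <= c xi) -> 0 < beta < 1 ->
  stationary c beta mu -> stationary c beta nu -> mu = nu.
Proof.
move=> c0 hb [[m0 m1] /invariant_expect im] [[n0 n1] /invariant_expect in_].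
pose v x := mu x - nu x.
have iv : invariant c beta v.
  move=> y; under eq_bigr do rewrite mulrBl.
  by rewrite sumrB im in_ subrr.
have inv := invariant_norm c0 hb iv.
have sv : \sum_x v x = 0 by rewrite sumrB m1 n1 subrr.
have ip : invariant c beta (fun x => `|v x| + v x).
  by move=> y; under eq_bigr do rewrite mulrDl; rewrite big_split /= inv iv addr0.
have p0 x : 0 <= `|v x| + v x by rewrite -lerBlDr sub0r -normrN ler_norm.
have [/existsP[x0 /eqP vx0]|/existsPn neg] :=
    boolP [exists x, `|v x| + v x == 0].
  have all0 x : `|v x| = - v x.
    by apply/eqP; rewrite -addr_eq0; apply/eqP; move: vx0; exact: (invariant_zero c0 hb ip p0).
  have : \sum_x `|v x| = 0 by under eq_bigr do rewrite all0; rewrite sumrN sv oppr0.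
  move/eqP; rewrite psumr_eq0 // => /allP h; apply/ffunP => x.
  by have := h x; rewrite mem_index_enum => /(_ isT)/=; rewrite normr_eq0 subr_eq0 => /eqP.
have pos x : 0 <= v x.
  rewrite leNgt; apply/negP => vx; move: (neg x).
  by rewrite ltr0_norm // addNr eqxx.
move/eqP: sv; rewrite psumr_eq0 // => /allP h; apply/ffunP => x.
by have := h x; rewrite mem_index_enum => /(_ isT)/=; rewrite subr_eq0 => /eqP.
Qed.

Lemma stationary_exists (R : realType) (p : nat) (c : config p -> R) (beta : R)
    (N : nat) : (forall xi, 0 <= c xi) -> 0 < beta < 1 ->
  exists mu : {ffun Omega N -> R}, stationary c beta mu.
Proof.
move=> c0 hb; pose n := #|{: Omega N}|.
pose M : 'M[R]_n := \matrix_(i, j) qmat c beta (enum_val i) (enum_val j).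
have ev (F : Omega N -> R) : \sum_x F x = \sum_(i < n) F (enum_val i).
  by rewrite (reindex (@enum_val _ (mem {: Omega N}))) //; exact/onW_bij/enum_val_bij.
have n0 : (0 < n)%N by apply/card_gt0P; exists [ffun=> false].
have : \det M^T == 0.
  apply/det0P; exists (const_mx 1).
    apply/eqP => /matrixP/(_ 0 (Ordinal n0)); rewrite !mxE => /eqP.
    by rewrite oner_eq0.
  apply/matrixP => i j; rewrite !mxE -[RHS](qmat_row c beta (enum_val j)) ev.
  by apply: eq_bigr => k _; rewrite !mxE mul1r.
rewrite det_tr => /det0P[w w0 wM].
pose v (x : Omega N) := w 0 (enum_rank x).
have iv : invariant c beta v.
  move=> y; move/matrixP: wM => /(_ 0 (enum_rank y)); rewrite !mxE => h; rewrite -[RHS]h.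
  rewrite (ev (fun x => v x * qmat c beta x y)).
  by apply: eq_bigr => k _; rewrite /v !mxE enum_valK enum_rankK.
have inv := invariant_norm c0 hb iv.
pose s := \sum_x `|v x|.
have s0 : s != 0.
  apply/eqP => /eqP; rewrite psumr_eq0 // => /allP h; case/eqP: w0.
  apply/matrixP => i j; rewrite ord1 !mxE.
  have := h (enum_val j); rewrite mem_index_enum => /(_ isT) /=.
  by rewrite normr_eq0 /v enum_valK => /eqP.
exists [ffun x => `|v x| / s]; split; last first.
  apply/invariant_expect => y.
  under eq_bigr do rewrite ffunE mulrAC.
  by rewrite -mulr_suml inv mul0r.
split=> [x|].
  by rewrite ffunE divr_ge0 //; apply: sumr_ge0.
by under eq_bigr do rewrite ffunE; rewrite -mulr_suml divff.
Qed.

Lemma stationary_stat_state (R : realType) (p : nat) (c : config p -> R)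
    (beta : R) (N : nat) : (forall xi, 0 <= c xi) -> 0 < beta < 1 ->
  stationary c beta (stat_state c beta N).
Proof. by move=> c0 hb; apply: xgetPex; exact: stationary_exists. Qed.

(* Main.v *)
Require Import Defs.
From mathcomp Require Import all_boot all_order all_algebra.
From mathcomp Require Import all_classical all_reals all_analysis.
From mathcomp Require Import ring lra zify.
Import Order.TTheory GRing.Theory Num.Theory.
Import numFieldNormedType.Exports.
Local Open Scope classical_set_scope.
Local Open Scope ring_scope.

(** The argument tests the stationarity equations E [L f] = 0 against
    well-chosen functions f, for each fixed N. Write n = N - 1 for the number
    of sites and L for the generator, and let the influence of a site on a
    function u be the maximal change of u when that site is flipped.

    The first idea is a maximum principle. If - L u = b - E b with b a function
    of the first p sites, then evaluating the equation at a configuration where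
    the influence of site k is attained bounds minus the discrete Laplacian of
    the influences by the influence of k on b, up to a killing rate A + B at
    site 1, a killing rate 1 at site n, and a creation of influence at the
    sites 2, ..., p at a rate at most the total excess Lambda of lambda times
    the influence of site 1 (poisson_influence). Since (p - 1) Lambda < A + B,
    testing these inequalities against the weights min(k, m) bounds all
    influences by a constant and the influence of the last site by a constant
    over n, uniformly in n and beta (poisson_bound). The same bound makes the
    Poisson equation solvable (poisson_exists).

    Apply the Poisson solution of a short system to the restriction of a
    configuration of a longer one. The two generators differ only at the right
    end of the short system, so that the stationary means of b differ by at
    most a constant over n, whatever the two values of beta
    (local_mean_compare). Take for b the reservoir density
    eta_1 + c (1 - 2 eta_1): with the value b at site 0 and beta at site N, the
    generator acts on the occupation variables as the discrete Laplacian. Hence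
    the density profile is exactly affine from E b to beta (stationary_density),
    and the limit alpha of E b is the limit of the density at site 1.

    For the law of large numbers, let G be the Dirichlet Green function of the
    segment and let W_i be the sum over j of G(i, j) (eta_j - rho_j). Adding
    G(i, 1) times the Poisson solution of b to the i-th row of G gives a
    function h_i with - L h_i = eta_i - rho_i exactly, and stationarity turns
    E [h_i (eta_i - rho_i)] into half the mean of the carre du champ of h_i,
    which is of order N because the slopes of G and the influences are bounded.
    Summing over i, the mean of the sum of the squared increments of W is of
    order N^2 (field_energy), to be compared with the trivial order N^3. A
    summation by parts then controls the field tested against sequences that
    vanish at both ends and have increments of order 1/N (smooth_field_bound),
    and every continuous test function is approximated on the grid, in mean, by
    such sequences (grid_lipschitz_approximation). *)

Set Implicit Arguments.
Unset Strict Implicit.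

(** * Flips, exchanges and restriction of configurations *)

(** The transposition of j and j + 1, as a function on site numbers. *)
Definition bond_swap (j k : nat) : nat :=
  if k == j then j.+1 else if k == j.+1 then j else k.

Lemma bond_swap_site (n j k : nat) :
  (0 < j < n)%N -> (0 < k <= n)%N -> (0 < bond_swap j k <= n)%N.
Proof. by rewrite /bond_swap => jn kn; do 2?[case: eqP => ?]; lia. Qed.

Lemma occ_exch_swap (n j k : nat) (eta : config n) :
  (0 < k <= n)%N -> occ (exch j eta) k = occ eta (bond_swap j k).
Proof. by move=> kn; rewrite occ_exch // /bond_swap; do 2?case: eqP. Qed.

(** Moving an exchange past a flip transports the flipped site: this is what turns
    the exchange dynamics into a random walk of the influences. *)
Lemma exch_flip (n j k : nat) (eta : config n) :
  (0 < j < n)%N -> (0 < k <= n)%N ->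
  exch j (flip k eta) = flip (bond_swap j k) (exch j eta).
Proof.
move=> jn kn; apply: occ_inj => i iN.
have ki := bond_swap_site jn iN.
rewrite occ_exch_swap // occ_flip // occ_flip // occ_exch_swap //.
have -> : (bond_swap j i == k) = (i == bond_swap j k).
  by rewrite /bond_swap; apply/eqP/eqP; do ![case: ifP => /eqP ?]; lia.
by [].
Qed.

Lemma flipC (n j k : nat) (eta : config n) :
  flip j (flip k eta) = flip k (flip j eta).
Proof.
by apply/ffunP => i; rewrite !ffunE; case: eqP; case: eqP.
Qed.

Lemma exch_flips (n k : nat) (eta : config n) : (0 < k < n)%N ->
  exch k eta = eta \/ exch k eta = flip k.+1 (flip k eta).
Proof.
move=> kn; have [e|ne] := eqVneq (occ eta k) (occ eta k.+1).
  left; apply: occ_inj => j jn; rewrite occ_exch //.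
  by case: eqP => [->|_] //; case: eqP => [->|].
right; apply: occ_inj => j jn; rewrite occ_exch // !occ_flip //.
case: (eqVneq j k) => [->|jk].
  rewrite ltn_eqF //; by move: ne; case: (occ _ _); case: (occ _ _).
case: (eqVneq j k.+1) => [->|//].
by move: ne; case: (occ _ _); case: (occ _ _).
Qed.

Lemma occ_window (p n : nat) (eta : config n) (k : nat) :
  (0 < k <= p)%N -> occ (window p eta) k = occ eta k.
Proof.
by case: k => // k kp; rewrite (occE (window p eta) (Ordinal kp)) ffunE.
Qed.

Lemma window_flip_out (p n k : nat) (eta : config n) :
  (p <= n)%N -> (p < k)%N -> window p (flip k eta) = window p eta.
Proof.
move=> pn pk; apply: occ_inj => j jp.
rewrite !occ_window // occ_flip; last lia.
by case: eqP => // jk; lia.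
Qed.

Lemma window_flip (p n k : nat) (eta : config n) :
  (p <= n)%N -> (0 < k <= p)%N -> window p (flip k eta) = flip k (window p eta).
Proof.
move=> pn kp; apply: occ_inj => j jp.
by rewrite occ_flip // !occ_window // occ_flip //; lia.
Qed.

Lemma window_exch (p n k : nat) (eta : config n) :
  (p <= n)%N -> (0 < k < p)%N -> window p (exch k eta) = exch k (window p eta).
Proof.
move=> pn kp; apply: occ_inj => j jp.
rewrite occ_exch_swap // !occ_window //; last exact: bond_swap_site.
by rewrite occ_exch_swap //; lia.
Qed.

Lemma window_exch_out (p n k : nat) (eta : config n) :
  (p <= n)%N -> (p < k)%N -> window p (exch k eta) = window p eta.
Proof.
move=> pn kp; apply: occ_inj => j jp.
rewrite !occ_window // occ_exch; last lia.
by do 2?[case: eqP => [?|_]]; lia.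
Qed.

Lemma window_window (p n m : nat) (eta : config m) :
  (p <= n)%N -> window p (window n eta) = window p eta.
Proof. by move=> pn; apply: occ_inj => j jp; rewrite !occ_window //; lia. Qed.

Lemma window_split (p : nat) (z : config p) : (0 < p)%N ->
  exists xi : Omega p, z = bcons (occ z 1) xi.
Proof.
move=> p0; exists [ffun i : 'I_p.-1 => occ z i.+2]; apply/ffunP => i.
rewrite !ffunE; case: eqP => i0.
  by rewrite -(occE z) i0.
have i1 : (i.-1 < p.-1)%N by have := ltn_ord i; lia.
have ip : i = (Ordinal i1).+1 :> nat by rewrite /=; lia.
by rewrite [in RHS]ip occE ffunE /= -(occE z); congr (occ z _); lia.
Qed.

Lemma occ_bcons1 (p : nat) a (xi : Omega p) : (0 < p)%N ->
  occ (bcons a xi) 1 = a.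
Proof. by move=> p0; rewrite (occE _ (Ordinal p0)) ffunE. Qed.

(** * Influence of a site on a function *)

Section Influence.
Variables (R : realType) (n : nat).
Implicit Types (u : config n -> R).

Definition infl (u : config n -> R) (k : nat) : R :=
  \big[Num.max/0]_eta (u (flip k eta) - u eta).

Lemma infl_ge0 u k : 0 <= infl u k.
Proof. exact: bigmax_ge_id. Qed.

Lemma inflP u k eta : u (flip k eta) - u eta <= infl u k.
Proof. exact: le_bigmax. Qed.

Lemma infl_norm u k eta : `|u (flip k eta) - u eta| <= infl u k.
Proof.
rewrite ler_norml inflP andbT lerNl opprB.
by rewrite -{1}(flipK k eta) inflP.
Qed.

Lemma infl_le u k (C : R) : 0 <= C ->
  (forall eta, u (flip k eta) - u eta <= C) -> infl u k <= C.
Proof. by move=> C0 h; apply: bigmax_le. Qed.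

(** The base value 0 of the maximum never exceeds all the differences, since
    flipping a configuration changes the sign of its difference. *)
Lemma infl_attained u k : exists eta, infl u k = u (flip k eta) - u eta.
Proof.
have [e He] : exists e, 0 <= u (flip k e) - u e.
  pose e0 : config n := [ffun=> false].
  have [h|h] := lerP 0 (u (flip k e0) - u e0); first by exists e0.
  by exists (flip k e0); rewrite flipK; lra.
pose F e := u (flip k e) - u e.
exists [arg max_(i > e) F i]%O.
have E : infl u k = \big[Num.max/F e]_i F i.
  apply/eqP; rewrite eq_le; apply/andP; split.
    by apply: bigmax_le => [|i _]; [apply: le_trans He (bigmax_ge_id _ _ _ _)|exact: le_bigmax].
  by apply: bigmax_le => [|i _]; exact: inflP.
rewrite E; case: arg_maxP => // i _ h.
apply/eqP; rewrite eq_le le_bigmax andbT; apply: bigmax_le => [|j _]; exact: h.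
Qed.

Lemma infl_exch u k eta : (0 < k < n)%N ->
  `|u (exch k eta) - u eta| <= infl u k + infl u k.+1.
Proof.
move=> kn; have [->|->] := exch_flips eta kn.
  by rewrite subrr normr0 addr_ge0 ?infl_ge0.
have := infl_norm u k.+1 (flip k eta); have := infl_norm u k eta.
by rewrite !ler_norml; lra.
Qed.

(** Two configurations are joined by flipping the sites where they differ, one at
    a time. *)
Lemma oscillation u eta zeta :
  `|u eta - u zeta| <= \sum_(1 <= k < n.+1) infl u k.
Proof.
suff H m : (m <= n)%N -> forall eta zeta,
    (forall j, (m < j <= n)%N -> occ eta j = occ zeta j) ->
    `|u eta - u zeta| <= \sum_(1 <= k < m.+1) infl u k.
  by apply: H => // j; lia.
elim: m => [|m IH] mn {}eta {}zeta h.
  by rewrite big_geq // (_ : eta = zeta) ?subrr ?normr0 //; apply: occ_inj.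
rewrite big_nat_recr //=.
pose eta' := if occ eta m.+1 == occ zeta m.+1 then eta else flip m.+1 eta.
have h1 : `|u eta - u eta'| <= infl u m.+1.
  rewrite /eta'; case: eqP => _; first by rewrite subrr normr0 infl_ge0.
  by rewrite distrC infl_norm.
have h2 : `|u eta' - u zeta| <= \sum_(1 <= k < m.+1) infl u k.
  apply: (IH (ltnW mn)) => j jm; rewrite /eta'; case: eqP => e.
    by case: (eqVneq j m.+1) => [->//|jm']; apply: h; lia.
  rewrite occ_flip; last lia.
  case: eqP => [->|jm']; first by move: e; case: (occ _ _); case: (occ _ _).
  by apply: h; lia.
by move: h1 h2; rewrite !ler_norml; lra.
Qed.

End Influence.

(** * The boundary rates *)

Section Rates.
Variables (R : realType) (p : nat) (c : config p -> R).
Hypotheses (p_gt0 : (0 < p)%N) (c_ge0 : forall xi, 0 <= c xi).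

Definition total_lambda : R :=
  \sum_(xi : Omega p) (lambda c false xi + lambda c true xi).

Lemma min_rate_le a xi : min_rate c a <= c (bcons a xi).
Proof. exact: bigmin_le. Qed.

Lemma min_rate_ge0 a : 0 <= min_rate c a.
Proof. by apply: le_bigmin. Qed.

Lemma lambda_ge0 a xi : 0 <= lambda c a xi.
Proof. by rewrite subr_ge0 min_rate_le. Qed.

Lemma total_lambda_ge0 : 0 <= total_lambda.
Proof. by apply: sumr_ge0 => xi _; rewrite addr_ge0 ?lambda_ge0. Qed.

Lemma rate_ge_min z : min_rate c (occ z 1) <= c z.
Proof. by have [xi ->] := window_split z p_gt0; rewrite occ_bcons1 // min_rate_le. Qed.

(** Two windows with the same first site but different tails share the minimal
    rate; the excesses are two distinct terms of the total, which is why their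
    sum, and not only each of them, is at most the total. *)
Lemma rates_pair x y : x != y -> occ x 1 = occ y 1 ->
  exists m lx ly, [/\ 0 <= m, c x = m + lx, c y = m + ly, 0 <= lx & 0 <= ly]
    /\ lx + ly <= total_lambda.
Proof.
move=> xy e; have [xi ex] := window_split x p_gt0.
have [zi ey] := window_split y p_gt0.
rewrite -e in ey; set a := occ x 1 in ex ey.
have xz : xi != zi by apply: contraNneq xy => h; rewrite ex ey h.
exists (min_rate c a), (lambda c a xi), (lambda c a zi); split.
  by split; rewrite ?min_rate_ge0 ?lambda_ge0 // /lambda addrC subrK ?{1}ex ?{1}ey.
rewrite /total_lambda (bigD1 xi) //= (bigD1 zi) /=; last by rewrite eq_sym.
rewrite addrA; apply: ler_wpDr.
  by apply: sumr_ge0 => i _; rewrite addr_ge0 ?lambda_ge0.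
have h b i := lambda_ge0 b i.
by apply: lerD; case: a {ex ey}; rewrite ?lerDl ?lerDr.
Qed.

End Rates.

(** * A maximum principle for the influences of a Poisson solution *)

Section PoissonInfluence.
Variables (R : realType) (p : nat) (c : config p -> R).
Hypotheses (p_gt0 : (0 < p)%N) (c_ge0 : forall xi, 0 <= c xi).
Variables (beta : R) (n : nat).
Hypotheses (beta01 : 0 < beta < 1) (pn : (p < n)%N).
Implicit Types (u g : config n -> R).

Notation L u := (@gen R p c beta n.+1 u).

(** Flipping site 1 kills the difference at the sum of a creation and an
    annihilation rate. A flip at k in 2, ..., p changes the rate by the excesses
    only, and each excess acts through a flip of site 1; farther sites do not
    see the left boundary. *)
Lemma left_gen_influence u k eta : (0 < k <= n)%N ->
  infl u k = u (flip k eta) - u eta ->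
  (k == 1)%N%:R * (min_rate c false + min_rate c true) * infl u 1
    - (1 < k <= p)%N%:R * total_lambda c * infl u 1
  <= left_gen c (N := n.+1) u eta - left_gen c (N := n.+1) u (flip k eta).
Proof.
move=> kn att; rewrite /left_gen /=.
have [k1|k1] := eqVneq k 1%N.
  subst k; rewrite /= mul1r !mul0r subr0 flipK att.
  rewrite -[u eta - _]opprB mulrN opprK -mulrDl ler_wpM2r //.
    by rewrite -att infl_ge0.
  have := rate_ge_min c p_gt0 (window p eta).
  have := rate_ge_min c p_gt0 (window p (flip 1 eta)).
  rewrite !occ_window; try lia; rewrite occ_flip /=; last lia.
  by case: (occ eta 1); lra.
rewrite !mul0r sub0r.
have key : 0 <= u (flip 1 eta) - u eta - (u (flip 1 (flip k eta)) - u (flip k eta)).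
  by rewrite (flipC 1); have := inflP u k (flip 1 eta); rewrite att; lra.
have [kp|kp] := leqP k p; last first.
  by rewrite andbF !mul0r oppr0 window_flip_out // -?mulrBr ?mulr_ge0 //; lia.
rewrite (_ : (1 < k)%N = true); last lia.
rewrite /= mul1r.
have [||m [lx [ly [[m0 -> -> lx0 ly0] lxy]]]] :=
  rates_pair p_gt0 c_ge0 (x := window p eta) (y := window p (flip k eta)).
- apply/eqP => /(congr1 (fun z => occ z k)).
  by rewrite !occ_window ?occ_flip ?eqxx; try lia; case: (occ eta k).
- by rewrite !occ_window ?occ_flip; try lia; rewrite eq_sym (negbTE k1).
have h1 := infl_norm u 1 eta; have h2 := infl_norm u 1 (flip k eta).
move: h1 h2 key.
set D1 := u (flip 1 eta) - u eta; set D2 := u (flip 1 (flip k eta)) - u (flip k eta).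
rewrite !ler_norml => /andP[h1 _] /andP[_ h2] key.
have a1 : lx * - infl u 1 <= lx * D1 by rewrite ler_wpM2l.
have a2 : ly * D2 <= ly * infl u 1 by rewrite ler_wpM2l.
have a3 : (lx + ly) * infl u 1 <= total_lambda c * infl u 1.
  by rewrite ler_wpM2r // infl_ge0.
have a4 : 0 <= m * (D1 - D2) by rewrite mulr_ge0.
nra.
Qed.

(** At a maximizer eta for site k, the configuration after the exchange (j, j + 1)
    has its discrepancy at the transported site, where the difference is at most
    the influence of that site. *)
Lemma bulk_gen_influence u k eta : (0 < k <= n)%N ->
  infl u k = u (flip k eta) - u eta ->
  \sum_(1 <= j < n) (infl u k - infl u (bond_swap j k))
  <= bulk_gen (N := n.+1) u eta - bulk_gen (N := n.+1) u (flip k eta).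
Proof.
move=> kn att; rewrite /bulk_gen /= -sumrB big_seq [leRHS]big_seq.
apply: ler_sum => j; rewrite mem_index_iota => jn.
rewrite exch_flip //; have := inflP u (bond_swap j k) (exch j eta).
by rewrite att; lra.
Qed.

(** The creation and annihilation rates at the last site add up to 1, so that a
    discrepancy there dies at rate 1. *)
Lemma right_gen_influence u k eta : (0 < k <= n)%N ->
  infl u k = u (flip k eta) - u eta ->
  (k == n)%:R * infl u n
  <= right_gen beta (N := n.+1) u eta - right_gen beta (N := n.+1) u (flip k eta).
Proof.
move=> kn att; rewrite /right_gen /=.
rewrite occ_flip //; last lia.
have [kn'|kn'] := eqVneq k n.
  subst k; rewrite flipK att.
  by case: (occ eta n) => /=; lra.
rewrite mul0r.
rewrite -mulrBr mulr_ge0 ?(ltW (right_rate_gt0 _ beta01)) //.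
by rewrite (flipC n); have := inflP u k (flip n eta); rewrite att; lra.
Qed.

(** The maximum principle: the equation is evaluated at the two configurations
    where the influence of site k is attained, and subtracted. *)
Lemma poisson_influence u g k : (forall eta, - L u eta = g eta) ->
  (0 < k <= n)%N ->
  \sum_(1 <= j < n) (infl u k - infl u (bond_swap j k))
  + (k == 1)%N%:R * (min_rate c false + min_rate c true) * infl u 1
  + (k == n)%:R * infl u n
  - (1 < k <= p)%N%:R * total_lambda c * infl u 1 <= infl g k.
Proof.
move=> ug kn; have [eta att] := infl_attained u k.
apply: le_trans (inflP g k eta); rewrite -!ug /gen.
have := left_gen_influence kn att; have := bulk_gen_influence kn att.
have := right_gen_influence kn att.
lra.
Qed.

End PoissonInfluence.

(** Summation by parts for the reflected walk on the sites 1, ..., n. *)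
Lemma bond_summation (R : realType) (n : nat) (w a : nat -> R) :
  \sum_(1 <= k < n.+1) w k * (\sum_(1 <= j < n) (a (bond_swap j k) - a k))
  = - \sum_(1 <= j < n) (w j.+1 - w j) * (a j.+1 - a j).
Proof.
under eq_bigr do rewrite mulr_sumr.
rewrite exchange_big /= -sumrN big_seq [RHS]big_seq; apply: eq_bigr => j.
rewrite mem_index_iota => jn.
rewrite (bigD1_seq j) ?mem_index_iota ?iota_uniq //=; last lia.
rewrite -big_filter (bigD1_seq j.+1) ?filter_uniq ?iota_uniq //=; last first.
  by rewrite mem_filter mem_index_iota; lia.
rewrite big_seq_cond big1 => [|k].
  by rewrite /bond_swap !eqxx gtn_eqF //; lra.
rewrite mem_filter => /andP[/andP[k1 _] k2].
by rewrite /bond_swap (negbTE k1) (negbTE k2) subrr mulr0.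
Qed.

Lemma window_site_counts (R : realType) (p n : nat) : (0 < p)%N -> (p <= n)%N ->
  \sum_(1 <= k < n.+1) (1 < k <= p)%N%:R = (p - 1)%:R :> R /\
  \sum_(1 <= k < n.+1) (k <= p)%N%:R = p%:R :> R.
Proof.
move=> p0 pn; have cut (F : nat -> bool) : (forall k, (p < k)%N -> F k = false) ->
    \sum_(1 <= k < n.+1) (F k)%:R = \sum_(1 <= k < p.+1) (F k)%:R :> R.
  move=> h; rewrite (@big_cat_nat _ _ _ p.+1) //= [X in _ + X]big_nat.
  by rewrite [X in _ + X]big1 ?addr0 // => k /andP[pk _]; rewrite h.
split.
  rewrite cut => [|k pk]; last lia.
  rewrite big_ltn // ltnn add0r.
  transitivity (\sum_(2 <= k < p.+1) (1 : R)).
    by rewrite big_nat [RHS]big_nat; apply: eq_bigr => k kp; rewrite (_ : (_ < _ <= _)%N) //; lia.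
  by rewrite sumr_const_nat subSS.
rewrite cut => [|k pk]; last lia.
transitivity (\sum_(1 <= k < p.+1) (1 : R)).
  by rewrite big_nat [RHS]big_nat; apply: eq_bigr => k kp; rewrite (_ : (_ <= _)%N) //; lia.
by rewrite sumr_const_nat subSS subn0.
Qed.

Section PoissonBound.
Variables (R : realType) (p : nat) (c : config p -> R).
Hypotheses (p_gt0 : (0 < p)%N) (c_ge0 : forall xi, 0 <= c xi).
Hypothesis small :
  (p - 1)%:R * total_lambda c < min_rate c false + min_rate c true.

(** The maximum principle tested against the weights min(k, m). They are concave,
    their slope is 1 up to m and 0 beyond, so that the bulk contributes the
    telescoping difference between the influences of m and of 1. *)
Lemma weighted_influence (b : config p -> R) (beta : R) (n m : nat)
    (u : config n -> R) (e : R) : 0 < beta < 1 -> (p < n)%N -> (0 < m <= n)%N ->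
  (forall eta, - gen c beta (N := n.+1) u eta = b (window p eta) - e) ->
  infl u m - infl u 1 + (min_rate c false + min_rate c true) * infl u 1
    + m%:R * infl u n
    - (minn p m)%:R * (p - 1)%:R * total_lambda c * infl u 1
  <= (minn p m)%:R * p%:R * \sum_(xi : config p) `|b xi| *+ 2.
Proof.
move=> beta01 pn mn ub.
pose g (eta : config n) := b (window p eta) - e.
pose S : R := \sum_(xi : config p) `|b xi| *+ 2.
have infg k : (0 < k <= n)%N -> infl g k <= (k <= p)%N%:R * S.
  move=> kn; have S0 : 0 <= S by apply: sumr_ge0 => xi _; rewrite mulrn_wge0.
  apply: infl_le => [|eta]; first by rewrite mulr_ge0.
  rewrite /g; have [kp|kp] := leqP k p; last first.
    by rewrite window_flip_out ?subrr ?mul0r //; lia.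
  have bS x : `|b x| *+ 2 <= S.
    rewrite /S (bigD1 x) //= lerDl; apply: sumr_ge0 => y _; exact: mulrn_wge0.
  have := bS (window p (flip k eta)); have := bS (window p eta).
  have := ler_norm (b (window p (flip k eta))).
  have := ler_norm (- b (window p eta)); rewrite normrN /= mul1r; lra.
(* The weight is at most min(p, m) on the window, which gives p - 1 for the
   creation terms when m = 1. *)
pose w k : R := (minn k m)%:R.
have wp k : (k <= p)%N -> w k <= (minn p m)%:R by move=> kp; rewrite ler_nat; lia.
have ineq : \sum_(1 <= k < n.+1) w k *
   (\sum_(1 <= j < n) (infl u k - infl u (bond_swap j k))
  + (k == 1)%N%:R * (min_rate c false + min_rate c true) * infl u 1
  + (k == n)%:R * infl u n
  - (1 < k <= p)%N%:R * total_lambda c * infl u 1)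
    <= \sum_(1 <= k < n.+1) w k * infl g k.
  apply: ler_sum_nat => k kn; rewrite ler_wpM2l ?ler0n //.
  exact: (poisson_influence p_gt0 c_ge0 beta01 pn ub).
have rhs : \sum_(1 <= k < n.+1) w k * infl g k <= (minn p m)%:R * p%:R * S.
  have [_ <-] := window_site_counts R p_gt0 (ltnW pn).
  rewrite -mulrA mulr_suml mulr_sumr; apply: ler_sum_nat => k kn.
  have := infg k kn; have [kp|kp] := leqP k p => h.
    by apply: ler_pM; rewrite ?infl_ge0 ?wp ?ler0n.
  rewrite mul0r mulr0; rewrite mul0r in h.
  by rewrite (_ : infl g k = 0) ?mulr0 //; apply/eqP; rewrite eq_le h infl_ge0.
apply: le_trans rhs; apply: le_trans ineq.
under eq_bigr do rewrite mulrBr mulrDr mulrDr.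
rewrite sumrB !big_split /=.
set T1 := \sum_(1 <= k < n.+1) _ * (\sum_(_ <= _ < _) _).
have -> : T1 = infl u m - infl u 1.
  transitivity (\sum_(1 <= j < n) (w j.+1 - w j) * (infl u j.+1 - infl u j)).
    rewrite -[RHS]opprK -bond_summation -sumrN; apply: eq_bigr => k _.
    by rewrite -mulrN -sumrN; congr (_ * _); apply: eq_bigr => j _; rewrite opprB.
  rewrite (@big_cat_nat _ _ _ m) //=; try lia.
  rewrite [X in _ + X]big_nat [X in _ + X]big1 ?addr0 => [|k kn]; last first.
    by rewrite /w (_ : minn k.+1 m = minn k m) ?subrr ?mul0r //; lia.
  rewrite -telescope_sumr; last lia.
  rewrite big_nat [RHS]big_nat; apply: eq_bigr => k kn.
  by rewrite /w (minn_idPl _) ?(minn_idPl _); try lia; rewrite -natrB // subSnn mul1r.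
have -> : \sum_(1 <= k < n.+1) w k * ((k == 1)%N%:R * (min_rate c false + min_rate c true) * infl u 1)
    = (min_rate c false + min_rate c true) * infl u 1.
  rewrite big_ltn; last lia.
  rewrite eqxx mul1r big_nat big1 => [|k kn].
    by rewrite /w (minn_idPl _) ?mul1r ?addr0 //; lia.
  by rewrite (_ : (k == 1)%N = false) ?mul0r ?mulr0 //; lia.
have -> : \sum_(1 <= k < n.+1) w k * ((k == n)%:R * infl u n) = m%:R * infl u n.
  rewrite big_nat_recr; last lia.
  rewrite /= eqxx mul1r big_nat big1 => [|k kn].
    by rewrite /w (minn_idPr _) ?add0r //; lia.
  by rewrite (_ : (k == n)%N = false) ?mul0r ?mulr0 //; lia.
rewrite lerD2l lerN2.
have [<- _] := window_site_counts R p_gt0 (ltnW pn).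
rewrite -!mulrA mulr_suml mulr_sumr; apply: ler_sum_nat => k kn.
rewrite -!mulrA; have [kp|] := boolP (_ < _ <= _)%N; last by rewrite !(mul0r, mulr0).
rewrite !mul1r ler_wpM2r ?mulr_ge0 ?total_lambda_ge0 ?infl_ge0 // wp //.
by case/andP: kp.
Qed.

(** With m = 1 the smallness condition bounds the influence of site 1, which then
    controls the creation terms for every m. *)
Lemma poisson_bound : exists2 K : R, 0 <= K &
  forall (b : config p -> R) (beta : R) (n : nat) (u : config n -> R) (e : R),
  0 < beta < 1 -> (p < n)%N ->
  (forall eta, - gen c beta (N := n.+1) u eta = b (window p eta) - e) ->
  forall m, (0 < m <= n)%N ->
  infl u m + m%:R * infl u n <= K * \sum_(xi : config p) `|b xi| *+ 2.
Proof.
pose K := min_rate c false + min_rate c true.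
have L0 := total_lambda_ge0 c.
have kappa : 0 < K - (p - 1)%:R * total_lambda c by rewrite subr_gt0.
(* The bound on the influence of site 1, per unit of the total size of b. *)
pose C1 : R := p%:R / (K - (p - 1)%:R * total_lambda c).
have C10 : 0 <= C1 by rewrite divr_ge0 // ltW.
pose q : R := p%:R * (p - 1)%:R * total_lambda c.
have q0 : 0 <= q by rewrite !mulr_ge0.
have pp : 0 <= p%:R * p%:R :> R by rewrite mulr_ge0.
have K0 : 0 <= K by rewrite addr_ge0 // min_rate_ge0.
exists ((1 + q) * C1 + p%:R * p%:R) => [|b beta n u e beta01 pn ub m mn].
  by rewrite addr_ge0 // mulr_ge0 // addr_ge0.
pose S : R := \sum_(xi : config p) `|b xi| *+ 2.
have S0 : 0 <= S by apply: sumr_ge0 => xi _; rewrite mulrn_wge0.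
have d1 : infl u 1 <= C1 * S.
  have m1 : (0 < 1 <= n)%N by lia.
  have := weighted_influence beta01 pn m1 ub.
  rewrite (minn_idPr p_gt0) -/S -/K !mul1r subrr add0r.
  have -> : C1 * S = p%:R * S / (K - (p - 1)%:R * total_lambda c).
    by rewrite /C1 mulrAC.
  rewrite ler_pdivlMr // => h.
  have := infl_ge0 u n; lra.
have := weighted_influence beta01 pn mn ub; rewrite -/S.
have pm : (minn p m)%:R <= p%:R :> R by rewrite ler_nat geq_minl.
have h1 : (minn p m)%:R * p%:R * S <= p%:R * p%:R * S.
  by rewrite ler_wpM2r // ler_wpM2r.
have h2 : (minn p m)%:R * (p - 1)%:R * total_lambda c * infl u 1 <= q * infl u 1.
  by rewrite ler_wpM2r ?infl_ge0 // ler_wpM2r // ler_wpM2r.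
have h3 : (1 + q) * infl u 1 <= (1 + q) * (C1 * S) by rewrite ler_wpM2l // addr_ge0.
have h4 : 0 <= K * infl u 1 by rewrite mulr_ge0 ?infl_ge0.
rewrite -/K; lra.
Qed.

End PoissonBound.

(** * Expectations and solvability of the Poisson equation *)

Section Expectation.
Variables (R : realType) (T : finType) (mu : {ffun T -> R}).
Hypothesis mu_distr : is_distr mu.
Implicit Types (f g : T -> R).

Lemma expectD f g : expect mu (fun x => f x + g x) = expect mu f + expect mu g.
Proof. by rewrite -big_split; apply: eq_bigr => x _; rewrite mulrDr. Qed.

Lemma expectZ (a : R) f : expect mu (fun x => a * f x) = a * expect mu f.
Proof. by rewrite mulr_sumr; apply: eq_bigr => x _; rewrite mulrCA. Qed.

Lemma expect_sum (I : Type) (r : seq I) (F : I -> T -> R) :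
  expect mu (fun x => \sum_(i <- r) F i x) = \sum_(i <- r) expect mu (F i).
Proof. by rewrite exchange_big; apply: eq_bigr => x _; rewrite mulr_sumr. Qed.

Lemma eq_expect f g : f =1 g -> expect mu f = expect mu g.
Proof. by move=> fg; apply: eq_bigr => x _; rewrite fg. Qed.

Lemma expect_cst (a : R) : expect mu (fun=> a) = a.
Proof. by rewrite /expect -mulr_suml; case: mu_distr => _ ->; rewrite mul1r. Qed.

Lemma le_expect f g : (forall x, f x <= g x) -> expect mu f <= expect mu g.
Proof.
by move=> fg; apply: ler_sum => x _; rewrite ler_wpM2l //; case: mu_distr.
Qed.

Lemma norm_expect_le f (a : R) : (forall x, `|f x| <= a) -> `|expect mu f| <= a.
Proof.
move=> fa; rewrite ler_norml -[X in X <= _ <= _]expect_cst -[X in _ <= _ <= X]expect_cst.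
by rewrite !le_expect // => x; have := fa x; rewrite ler_norml => /andP[].
Qed.

End Expectation.

Lemma genD (R : realType) (p : nat) (c : config p -> R) (beta : R) (N : nat) (u v : Omega N -> R) eta :
  gen c beta (fun z => u z + v z) eta = gen c beta u eta + gen c beta v eta.
Proof.
by rewrite !gen_qmat -big_split; apply: eq_bigr => x _; rewrite mulrDr.
Qed.

Lemma genZ (R : realType) (p : nat) (c : config p -> R) (beta : R) (N : nat) (a : R) (u : Omega N -> R) eta :
  gen c beta (fun z => a * u z) eta = a * gen c beta u eta.
Proof.
by rewrite !gen_qmat mulr_sumr; apply: eq_bigr => x _; rewrite mulrCA.
Qed.

Section PoissonExists.
Variables (R : realType) (p : nat) (c : config p -> R).
Hypotheses (p_gt0 : (0 < p)%N) (c_ge0 : forall xi, 0 <= c xi).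
Hypothesis small :
  (p - 1)%:R * total_lambda c < min_rate c false + min_rate c true.

(** A harmonic function solves the Poisson equation with b = 0, so that the bound
    on the influences makes all of them vanish. *)
Lemma harmonic_constant (beta : R) (n : nat) (u : config n -> R) :
  0 < beta < 1 -> (p < n)%N ->
  (forall eta, gen c beta (N := n.+1) u eta = 0) ->
  forall eta zeta, u eta = u zeta.
Proof.
move=> beta01 pn h eta zeta.
have [K _ bound] := poisson_bound p_gt0 c_ge0 small.
have {}bound k : (0 < k < n.+1)%N -> infl u k = 0.
  move=> kn; apply/eqP; rewrite eq_le infl_ge0 andbT.
  have := bound (fun=> 0) beta n u 0 beta01 pn _ k kn.
  rewrite big1 => [|xi _]; last by rewrite normr0 mul0rn.
  rewrite mulr0; have := infl_ge0 u n; have : 0 <= k%:R :> R by [].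
  move=> k0 un0 H; have := H (fun eta => _).
  have h0 : 0 <= k%:R * infl u n by rewrite mulr_ge0.
  suff : infl u k + k%:R * infl u n <= 0 by lra.
  by apply: H => x; rewrite h subrr oppr0.
have := oscillation u eta zeta; rewrite big_nat big1 //.
by rewrite normr_le0 subr_eq0 => /eqP.
Qed.

(** The operator - L + E is injective: applying E to (- L + E) u = 0 gives E u = 0,
    so that u is harmonic, hence constant, hence 0. It is therefore onto, and
    applying E to (- L + E) u = g gives E u = E g. *)
Lemma poisson_exists (beta : R) (n : nat) (mu : {ffun Omega n.+1 -> R})
    (g : config n -> R) : 0 < beta < 1 -> (p < n)%N ->
  stationary c beta mu ->
  exists u : config n -> R,
    forall eta, - gen c beta (N := n.+1) u eta = g eta - expect mu g.
Proof.
move=> beta01 pn [mud mus].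
pose k := #|{: config n}|.
(* The transpose of the matrix of - L + E, to fit the row-vector convention. *)
pose M : 'M[R]_k := \matrix_(i, j)
  (- qmat c beta (N := n.+1) (enum_val j) (enum_val i) + mu (enum_val i)).
have ev (F : config n -> R) : \sum_x F x = \sum_(i < k) F (enum_val i).
  by rewrite (reindex (@enum_val _ (mem {: config n}))) //; exact/onW_bij/enum_val_bij.
have vM (v : 'rV[R]_k) x : (v *m M) 0 (enum_rank x)
    = - gen c beta (N := n.+1) (fun z => v 0 (enum_rank z)) x
      + expect mu (fun z => v 0 (enum_rank z)).
  rewrite mxE gen_qmat /expect !ev -sumrN -big_split /=; apply: eq_bigr => i _.
  by rewrite mxE !enum_valK enum_rankK; ring.
have Mu : M \in unitmx.
  rewrite unitmxE unitfE; apply/det0P => -[v v0 vM0].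
  pose u z := v 0 (enum_rank z).
  have uM x : - gen c beta (N := n.+1) u x + expect mu u = 0.
    by rewrite -vM vM0 mxE.
  have Eu : expect mu u = 0.
    have := mus u; rewrite -(expect_cst mud (expect mu u)).
    move=> E0; have := eq_expect mu uM.
    by rewrite expectD (eq_expect mu (fun x => esym (mulN1r (gen c beta (N := n.+1) u x)))) expectZ E0 mulr0 add0r !expect_cst.
  have u0 x : gen c beta (N := n.+1) u x = 0 by have := uM x; rewrite Eu; lra.
  have uc := harmonic_constant beta01 pn u0.
  have uz x : u x = 0.
    by rewrite -Eu -[LHS](expect_cst mud); apply: eq_expect => y; exact: uc.
  case/eqP: v0; apply/matrixP => i j; rewrite ord1 mxE.
  by have := uz (enum_val j); rewrite /u enum_valK.
pose v := (\row_i g (enum_val i)) *m invmx M.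
pose u z := v 0 (enum_rank z); exists u => x.
have uM y : - gen c beta (N := n.+1) u y + expect mu u = g y.
  by rewrite -vM mulmxKV // mxE enum_rankK.
suff <- : expect mu u = expect mu g by rewrite -uM addrK.
rewrite -(eq_expect mu uM) expectD expect_cst //.
rewrite (eq_expect mu (fun x => esym (mulN1r (gen c beta (N := n.+1) u x)))).
by rewrite expectZ mus mulr0 add0r.
Qed.

End PoissonExists.

(** * Comparison of stationary states of different lengths *)

Section Restriction.
Variables (R : realType) (p : nat) (c : config p -> R).

Lemma right_rate_le1 (beta : R) (b : bool) : 0 < beta < 1 ->
  beta * (1 - b%:R) + (1 - beta) * b%:R <= 1.
Proof. by case: b => /andP[]; rewrite /=; lra. Qed.

Lemma right_gen_le (beta : R) (n : nat) (u : config n -> R) eta : 0 < beta < 1 ->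
  `|right_gen beta (N := n.+1) u eta| <= infl u n.
Proof.
move=> beta01; rewrite /right_gen /= normrM ger0_norm; last first.
  by rewrite ltW // right_rate_gt0.
by rewrite -[leRHS]mul1r ler_pM ?normr_ge0 ?right_rate_le1 ?infl_norm // ltW // right_rate_gt0.
Qed.

Lemma window_id (n : nat) (eta : config n) : window n eta = eta.
Proof. by apply: occ_inj => j jn; rewrite occ_window. Qed.

(** Away from the right end of the short system the dynamics commute with the
    restriction. At that end the long system exchanges n and n + 1, or flips n
    with another rate, instead of the flip of the short system. *)
Lemma restriction_generator (beta beta' : R) (n n' : nat) (u : config n -> R)
    (eta : config n') : 0 < beta < 1 -> 0 < beta' < 1 -> (p < n)%N -> (n <= n')%N ->
  `|gen c beta' (N := n'.+1) (fun z : config n' => u (window n z)) eta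
    - gen c beta (N := n.+1) u (window n eta)| <= infl u n *+ 2.
Proof.
move=> b01 b01' pn nn'; have [e|lt] := eqVneq n n'.
  subst n'; rewrite (_ : (fun z => u (window n z)) = u); last first.
    by apply/funext => z; rewrite window_id.
  rewrite window_id /gen.
  have := right_gen_le u eta b01; have := right_gen_le u eta b01'.
  by rewrite !ler_norml; lra.
have {nn'} nn' : (n < n')%N by lia.
have lefteq : left_gen c (N := n'.+1) (fun z : config n' => u (window n z)) eta
    = left_gen c (N := n.+1) u (window n eta).
  rewrite /left_gen /= window_window ?(ltnW pn) // window_flip //; lia.
have rightz : right_gen beta' (N := n'.+1) (fun z : config n' => u (window n z)) eta = 0.
  by rewrite /right_gen /= window_flip_out ?subrr ?mulr0 //; lia.
have bulk : bulk_gen (N := n'.+1) (fun z : config n' => u (window n z)) eta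
    = bulk_gen (N := n.+1) u (window n eta) + (u (window n (exch n eta)) - u (window n eta)).
  rewrite /bulk_gen /= (@big_cat_nat _ _ _ n) //=; try lia.
  congr (_ + _).
    by apply: eq_big_nat => j jn; rewrite window_exch //; lia.
  rewrite big_ltn // big_nat big1 ?addr0 // => j jn.
  by rewrite window_exch_out ?subrr //; lia.
have jump : `|u (window n (exch n eta)) - u (window n eta)| <= infl u n.
  have n_in : (0 < n < n')%N by lia.
  have [->|->] := exch_flips eta n_in; first by rewrite subrr normr0 infl_ge0.
  by rewrite window_flip_out ?window_flip ?infl_norm //; lia.
rewrite /gen lefteq rightz bulk.
have := right_gen_le u (window n eta) b01; move: jump; rewrite !ler_norml; lra.
Qed.

End Restriction.

Section LocalMeans.
Variables (R : realType) (p : nat) (c : config p -> R).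
Hypotheses (p_gt0 : (0 < p)%N) (c_ge0 : forall xi, 0 <= c xi).
Hypothesis small :
  (p - 1)%:R * total_lambda c < min_rate c false + min_rate c true.

(** The function u is the Poisson solution of b in the short system. In the long
    system the generator applied to u after restriction has mean 0, and it
    differs from E b - b by at most twice the influence of the last site. *)
Lemma local_mean_compare (b : config p -> R) : exists2 C : R, 0 <= C &
  forall (beta beta' : R) (n n' : nat) (mu : {ffun Omega n.+1 -> R})
    (mu' : {ffun Omega n'.+1 -> R}),
  0 < beta < 1 -> 0 < beta' < 1 -> (p < n)%N -> (n <= n')%N ->
  stationary c beta mu -> stationary c beta' mu' ->
  `|expect mu (fun eta : config n => b (window p eta))
    - expect mu' (fun eta : config n' => b (window p eta))| <= C / n%:R.
Proof.
have [K K0 bound] := poisson_bound p_gt0 c_ge0 small.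
have S0 : 0 <= \sum_(xi : config p) `|b xi| *+ 2.
  by apply: sumr_ge0 => xi _; rewrite mulrn_wge0.
exists (K * (\sum_(xi : config p) `|b xi| *+ 2) *+ 2) => [|beta beta' n n' mu mu' b01 b01' pn nn' st st'].
  by rewrite mulrn_wge0 // mulr_ge0.
have [u ub] := poisson_exists p_gt0 c_ge0 small (fun eta : config n => b (window p eta)) b01 pn st.
have n0 : (0 < n <= n)%N by lia.
have un := bound b beta n u _ b01 pn ub n n0.
have nR : 0 < n%:R :> R by rewrite ltr0n; lia.
have {}un : infl u n *+ 2 <= K * (\sum_(xi : config p) `|b xi| *+ 2) *+ 2 / n%:R.
  by rewrite ler_pdivlMr //; have := infl_ge0 u n; lra.
apply: le_trans un.
pose err (eta : config n') := gen c beta' (N := n'.+1) (fun z : config n' => u (window n z)) eta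
    - gen c beta (N := n.+1) u (window n eta).
have Eerr : expect mu (fun eta : config n => b (window p eta))
    - expect mu' (fun eta : config n' => b (window p eta)) = - expect mu' err.
  case: st' => d' s'.
  have := s' (fun z : config n' => u (window n z)).
  rewrite (@eq_expect _ _ _ _ (fun eta : config n' => err eta +
    (expect mu (fun eta : config n => b (window p eta)) + (-1) * b (window p eta)))).
    by rewrite (expectD _ err) [X in _ + X]expectD expect_cst // expectZ mulN1r => h; apply/eqP; rewrite -subr_eq0 opprK addrC h.
  move=> eta; rewrite /err; have := ub (window n eta).
  by rewrite window_window ?(ltnW pn) //; lra.
rewrite Eerr normrN; apply: norm_expect_le => [|eta]; first by case: st'.
exact: restriction_generator.
Qed.

End LocalMeans.

(** * Linear functionals, the Green function and the density profile *)

Lemma summation_by_parts (R : realType) (x w : nat -> R) (M : nat) :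
  \sum_(0 <= j < M.+1) (w j.+1 - w j) * (x j.+1 - x j)
  = \sum_(1 <= k < M.+1) x k * (w k *+ 2 - w k.-1 - w k.+1)
    + x M.+1 * (w M.+1 - w M) - x 0%N * (w 1%N - w 0%N).
Proof.
elim: M => [|M IH]; first by rewrite big_nat1 big_geq //; ring.
by rewrite big_nat_recr //= IH [in RHS]big_nat_recr //=; ring.
Qed.

(** The inverse of minus the Dirichlet Laplacian on 1, ..., N - 1, written so that
    its linear part and its kink at i are separated. *)
Definition green (R : realType) (N i k : nat) : R :=
  (minn i k)%:R - (i * k)%:R / N%:R.

Section Green.
Variables (R : realType) (N : nat).
Hypothesis N_gt0 : (0 < N)%N.
Notation G := (@green R N).

Let N_neq0 : N%:R != 0 :> R. Proof. by rewrite pnatr_eq0; lia. Qed.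

Lemma greenC i k : G i k = G k i.
Proof. by rewrite /green minnC mulnC. Qed.

Lemma green0 i : G i 0 = 0.
Proof. by rewrite /green minn0 muln0 mul0r subr0. Qed.

Lemma greenN i : (i <= N)%N -> G i N = 0.
Proof. by move=> iN; rewrite /green (minn_idPl iN) natrM mulfK ?subrr. Qed.

Lemma green1 i : (0 < i)%N -> G i 1 = 1 - i%:R / N%:R.
Proof. by move=> i0; rewrite /green (minn_idPr i0) muln1. Qed.

Lemma green_pred i : (i < N)%N -> G i N.-1 = i%:R / N%:R.
Proof.
move=> iN; rewrite /green (minn_idPl _); last lia.
by rewrite natrM -subn1 natrB //; field.
Qed.

Lemma green_laplacian i k : (0 < k)%N ->
  G i k *+ 2 - G i k.-1 - G i k.+1 = (k == i)%N%:R.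
Proof.
case: k => // k _; rewrite /green /= !natrM -!natr1.
have [ki|ki|ki] := ltngtP k.+1 i.
- rewrite !(minn_idPr _) -?natr1 /=; try lia.
  by field.
- by rewrite !(minn_idPl _) /=; try lia; field.
subst i; rewrite (minn_idPr _) ?(minn_idPl _) -?natr1 /=; try lia.
by field.
Qed.

Lemma ratio_le1 i : (i <= N)%N -> 0 <= (i%:R / N%:R : R) <= 1.
Proof.
by move=> iN; rewrite divr_ge0 // ler_pdivrMr ?ltr0n // mul1r ler_nat iN.
Qed.

Lemma green_slope i k : (i <= N)%N -> `|G i k.+1 - G i k| <= 1.
Proof.
move=> iN; rewrite /green.
have -> : (minn i k.+1)%:R - (i * k.+1)%:R / N%:R - ((minn i k)%:R - (i * k)%:R / N%:R)
    = (k < i)%N%:R - i%:R / N%:R :> R.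
  rewrite !natrM -natr1; have [ki|ki] := ltnP k i.
    by rewrite !(minn_idPr _) -?natr1 /=; try lia; field.
  by rewrite !(minn_idPl _) /=; try lia; field.
have := ratio_le1 iN; rewrite ler_norml => /andP[h1 h2].
by case: (k < i)%N => /=; lra.
Qed.

End Green.

Section LinearFunctionals.
Variables (R : realType) (p : nat) (c : config p -> R).
Hypothesis p_gt0 : (0 < p)%N.

(** The density at a virtual site 0 for which the boundary dynamics looks like the
    bulk one: L eta_1 = reservoir - 2 eta_1 + eta_2. *)
Definition reservoir (xi : config p) : R :=
  (occ xi 1)%:R + c xi * (1 - (occ xi 1)%:R *+ 2).

Definition profile (beta : R) (n : nat) (eta : config n) (k : nat) : R :=
  if k == 0%N then reservoir (window p eta)
  else if k == n.+1 then beta else (occ eta k)%:R.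

(** In terms of the profile extended by the reservoir at 0 and by beta at n + 1,
    both boundary generators are increments of the profile, like the bulk ones. *)
Lemma gen_linear (beta : R) (n : nat) (w : nat -> R) (eta : config n) :
  (p <= n)%N -> w 0%N = 0 -> w n.+1 = 0 ->
  gen c beta (N := n.+1)
    (fun z : config n => \sum_(1 <= k < n.+1) w k * (occ z k)%:R) eta
  = - \sum_(0 <= j < n.+1)
        (w j.+1 - w j) * (profile beta eta j.+1 - profile beta eta j).
Proof.
move=> pn w0 wN; have n0 : (0 < n)%N by lia.
pose X k : R := (occ eta k)%:R.
have diff (z : config n) :
    \sum_(1 <= k < n.+1) w k * (occ z k)%:R - \sum_(1 <= k < n.+1) w k * (occ eta k)%:R
    = \sum_(1 <= k < n.+1) w k * ((occ z k)%:R - X k).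
  by rewrite -sumrB; apply: eq_bigr => k _; rewrite -mulrBr.
have flip_diff i : (0 < i <= n)%N ->
    \sum_(1 <= k < n.+1) w k * ((occ (flip i eta) k)%:R - X k) = w i * (1 - X i *+ 2).
  move=> iN; rewrite (bigD1_seq i) ?mem_index_iota ?iota_uniq //=.
  rewrite occ_flip // eqxx -big_filter big_seq big1 => [|k].
    by rewrite /X; case: (occ eta i); rewrite /=; lra.
  rewrite mem_filter mem_index_iota => /andP[ki kn].
  by rewrite occ_flip // (negbTE ki) subrr mulr0.
have bulk : bulk_gen (N := n.+1)
    (fun z : config n => \sum_(1 <= k < n.+1) w k * (occ z k)%:R) eta
    = - \sum_(1 <= j < n) (w j.+1 - w j) * (X j.+1 - X j).
  rewrite /bulk_gen /= -bond_summation.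
  under [RHS]eq_bigr do rewrite mulr_sumr.
  rewrite [RHS]exchange_big /= big_seq [RHS]big_seq; apply: eq_bigr => j.
  rewrite mem_index_iota => jn; rewrite diff.
  by apply: eq_big_nat => k kn; rewrite occ_exch_swap.
rewrite /gen bulk /left_gen /right_gen !diff !flip_diff //; try lia.
have mid : \sum_(0 <= j < n.+1) (w j.+1 - w j) * (profile beta eta j.+1 - profile beta eta j)
    = w 1%N * (X 1%N - reservoir (window p eta))
      + \sum_(1 <= j < n) (w j.+1 - w j) * (X j.+1 - X j) - w n * (beta - X n).
  rewrite big_nat_recr //= big_ltn // w0 wN subr0 sub0r mulNr.
  rewrite /profile eqxx (_ : (n.+1 == 0)%N = false) // (_ : (n == 0)%N = false); last lia.
  rewrite (_ : (n == n.+1)%N = false); last lia.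
  rewrite (_ : (1 == n.+1)%N = false); last lia.
  rewrite eqxx; congr (_ + _ - _).
  apply: eq_big_nat => k kn.
  rewrite (_ : (k == 0)%N = false); last lia.
  rewrite (_ : (k == n.+1)%N = false); last lia.
  by rewrite (_ : (k.+1 == n.+1)%N = false); last lia.
rewrite mid /reservoir occ_window; last lia.
by rewrite /X; case: (occ eta n); case: (occ eta 1); rewrite /=; ring.
Qed.

(** Two summations by parts move the Laplacian onto the Green function; what is
    left of the profile is its value at i and at the two ends. *)
Lemma gen_green (beta : R) (n i : nat) (eta : config n) :
  (p <= n)%N -> (0 < i <= n)%N ->
  gen c beta (N := n.+1)
    (fun z : config n => \sum_(1 <= k < n.+1) green R n.+1 i k * (occ z k)%:R) eta
  = green R n.+1 i 1 * reservoir (window p eta) + i%:R / n.+1%:R * beta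
    - (occ eta i)%:R.
Proof.
move=> pn iN.
have gN : green R n.+1 i n.+1 = 0 by apply: greenN; lia.
have gn : green R n.+1 i n = i%:R / n.+1%:R by apply: (@green_pred R n.+1); lia.
have g0 : green R n.+1 i 0 = 0 by exact: green0.
rewrite gen_linear //.
rewrite summation_by_parts (bigD1_seq i) ?mem_index_iota ?iota_uniq //=.
rewrite green_laplacian ?eqxx //; last lia.
rewrite -big_filter big_seq big1 => [|k]; last first.
  rewrite mem_filter mem_index_iota => /andP[ki kn].
  by rewrite green_laplacian ?(negbTE ki) ?mulr0 //; lia.
rewrite g0 gN gn.
rewrite /profile eqxx (_ : (n.+1 == 0)%N = false) // eqxx.
rewrite (_ : (i == 0)%N = false); last lia.
rewrite (_ : (i == n.+1)%N = false); last lia.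
by rewrite /=; ring.
Qed.

End LinearFunctionals.

Section StationaryIdentities.
Variables (R : realType) (p : nat) (c : config p -> R).
Hypotheses (p_gt0 : (0 < p)%N) (c_ge0 : forall xi, 0 <= c xi).

(** The mean of gen_green under the stationary state. *)
Lemma stationary_density (beta : R) (n i : nat) (mu : {ffun Omega n.+1 -> R}) :
  (p <= n)%N -> (0 < i <= n)%N -> stationary c beta mu ->
  expect mu (fun eta : config n => (occ eta i)%:R)
  = (1 - i%:R / n.+1%:R) * expect mu (fun eta : config n => reservoir c (window p eta))
    + i%:R / n.+1%:R * beta.
Proof.
move=> pn iN [d s].
set A := expect mu (fun eta : config n => reservoir c (window p eta)).
set B := expect mu _.
have := s (fun z : config n => \sum_(1 <= k < n.+1) green R n.+1 i k * (occ z k)%:R).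
rewrite (@eq_expect _ _ _ _ (fun eta : config n =>
  green R n.+1 i 1 * reservoir c (window p eta) + (i%:R / n.+1%:R * beta
    + (-1) * (occ eta i)%:R))) => [|eta]; last by rewrite gen_green //; ring.
rewrite expectD expectZ -/A [X in _ + X]expectD expect_cst // expectZ -/B.
rewrite green1; last lia.
move=> AB; have : (1 - i%:R / n.+1%:R) * A + (i%:R / n.+1%:R * beta + (-1) * B) = 0 := AB.
by set x := (_ / _ : R); lra.
Qed.

Definition carre_du_champ (beta : R) (n : nat) (h : config n -> R) (eta : config n) : R :=
  c (window p eta) * (h (flip 1 eta) - h eta) ^+ 2
  + \sum_(1 <= j < n) (h (exch j eta) - h eta) ^+ 2
  + (beta * (1 - (occ eta n)%:R) + (1 - beta) * (occ eta n)%:R)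
    * (h (flip n eta) - h eta) ^+ 2.

Lemma gen_square (beta : R) (n : nat) (h : config n -> R) (eta : config n) :
  gen c beta (N := n.+1) (fun z => h z ^+ 2) eta
  = h eta * gen c beta (N := n.+1) h eta *+ 2 + carre_du_champ beta h eta.
Proof.
rewrite /gen /carre_du_champ /left_gen /right_gen /bulk_gen /=.
have -> : \sum_(1 <= k < n) (h (exch k eta) ^+ 2 - h eta ^+ 2)
    = h eta * (\sum_(1 <= k < n) (h (exch k eta) - h eta)) *+ 2
      + \sum_(1 <= j < n) (h (exch j eta) - h eta) ^+ 2.
  rewrite mulr_sumr -sumrMnl -big_split /=; apply: eq_bigr => k _; ring.
by ring.
Qed.

(** The generator applied to h^2 is 2 h L h plus the carre du champ of h, and its
    stationary mean is 0. *)
Lemma dirichlet_identity (beta : R) (n : nat) (mu : {ffun Omega n.+1 -> R})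
    (h : config n -> R) : stationary c beta mu ->
  expect mu (fun eta => h eta * - gen c beta (N := n.+1) h eta) *+ 2
  = expect mu (carre_du_champ beta h).
Proof.
move=> [d s]; have := s (fun z => h z ^+ 2).
rewrite (@eq_expect _ _ _ _ (fun eta : config n =>
  (- 2) * (h eta * - gen c beta (N := n.+1) h eta)
  + carre_du_champ beta h eta)) => [|eta]; last by rewrite gen_square; ring.
by rewrite (expectD _ _ (carre_du_champ beta h)) expectZ; lra.
Qed.

Lemma carre_du_champ_le (beta : R) (n : nat) (h : config n -> R) (a : R) eta :
  0 < beta < 1 -> (0 < n)%N -> 0 <= a ->
  `|h (flip 1 eta) - h eta| <= a -> `|h (flip n eta) - h eta| <= a ->
  (forall j, (0 < j < n)%N -> `|h (exch j eta) - h eta| <= a) ->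
  carre_du_champ beta h eta <= ((\sum_xi c xi) + n%:R) * a ^+ 2.
Proof.
move=> beta01 n0 a0 h1 h2 h3.
have sq (x : R) : `|x| <= a -> x ^+ 2 <= a ^+ 2.
  by move=> xa; rewrite -[x ^+ 2]real_normK ?num_real // ler_pXn2r ?nnegrE.
have A1 : c (window p eta) * (h (flip 1 eta) - h eta) ^+ 2 <= (\sum_xi c xi) * a ^+ 2.
  apply: ler_pM; rewrite ?sqr_ge0 ?sq // (bigD1 (window p eta)) //= lerDl.
  exact: sumr_ge0.
have A2 : \sum_(1 <= j < n) (h (exch j eta) - h eta) ^+ 2 <= (n - 1)%:R * a ^+ 2.
  apply: le_trans (_ : \sum_(1 <= j < n) a ^+ 2 <= _).
    by apply: ler_sum_nat => j jn; rewrite sq ?h3.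
  by rewrite sumr_const_nat mulr_natl.
have A3 : (beta * (1 - (occ eta n)%:R) + (1 - beta) * (occ eta n)%:R)
    * (h (flip n eta) - h eta) ^+ 2 <= 1 * a ^+ 2.
  by apply: ler_pM; rewrite ?sqr_ge0 ?sq ?right_rate_le1 // ltW ?right_rate_gt0.
move: A2; rewrite natrB // /carre_du_champ; lra.
Qed.

End StationaryIdentities.

(** * Variance of the fluctuation field *)

Section Fluctuations.
Variables (R : realType) (p : nat) (c : config p -> R).
Hypotheses (p_gt0 : (0 < p)%N) (c_ge0 : forall xi, 0 <= c xi).
Hypothesis small :
  (p - 1)%:R * total_lambda c < min_rate c false + min_rate c true.

Definition density (n : nat) (mu : {ffun Omega n.+1 -> R}) (k : nat) : R :=
  expect mu (fun eta : config n => (occ eta k)%:R).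

Definition centered (n : nat) (mu : {ffun Omega n.+1 -> R}) (k : nat)
    (eta : config n) : R := (occ eta k)%:R - density mu k.

Definition potential (n : nat) (mu : {ffun Omega n.+1 -> R}) (k : nat)
    (eta : config n) : R :=
  \sum_(1 <= j < n.+1) green R n.+1 k j * centered mu j eta.

Lemma centered_le1 (n : nat) (mu : {ffun Omega n.+1 -> R}) k eta :
  is_distr mu -> `|centered mu k eta| <= 1.
Proof.
move=> d; have h0 : 0 <= density mu k.
  by rewrite -(expect_cst d 0); apply: le_expect.
have h1 : density mu k <= 1.
  by rewrite -(expect_cst d 1); apply: le_expect => // x; case: (occ x k).
rewrite /centered ler_norml; case: (occ eta k) => /=; lra.
Qed.

Lemma expect_centered (n : nat) (mu : {ffun Omega n.+1 -> R}) k :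
  is_distr mu -> expect mu (centered mu k) = 0.
Proof.
move=> d; rewrite (expectD mu (fun eta : config n => (occ eta k)%:R) (fun=> - density mu k)).
by rewrite expect_cst // subrr.
Qed.

Lemma potential_laplacian (n : nat) (mu : {ffun Omega n.+1 -> R}) k eta :
  (0 < k <= n)%N ->
  potential mu k eta *+ 2 - potential mu k.-1 eta - potential mu k.+1 eta
  = centered mu k eta.
Proof.
move=> kn; rewrite /potential -sumrMnl -!sumrB.
have lap j : green R n.+1 k j *+ 2 - green R n.+1 k.-1 j - green R n.+1 k.+1 j
    = (k == j)%N%:R.
  rewrite (greenC _ _ k) (greenC _ _ k.-1) (greenC _ _ k.+1).
  by rewrite green_laplacian //; lia.
rewrite (bigD1_seq k) ?mem_index_iota ?iota_uniq //=.
rewrite -mulrnAl -!mulrBl lap eqxx mul1r.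
rewrite -big_filter big_seq big1 ?addr0 // => j.
rewrite mem_filter mem_index_iota => /andP[jk jn].
by rewrite -mulrnAl -!mulrBl lap eq_sym (negbTE jk) mul0r.
Qed.

Lemma potential0 (n : nat) (mu : {ffun Omega n.+1 -> R}) eta :
  potential mu 0 eta = 0.
Proof. by apply: big1 => j _; rewrite greenC green0 mul0r. Qed.

Lemma potentialN (n : nat) (mu : {ffun Omega n.+1 -> R}) eta :
  potential mu n.+1 eta = 0.
Proof.
rewrite /potential big_nat big1 // => j jn.
by rewrite greenC greenN ?mul0r //; lia.
Qed.

(** The centred occupation is minus the Laplacian of W. *)
Lemma pairing_potential (n : nat) (mu : {ffun Omega n.+1 -> R}) (h : nat -> R) eta :
  h 0%N = 0 -> h n.+1 = 0 ->
  \sum_(1 <= k < n.+1) h k * centered mu k eta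
  = \sum_(0 <= j < n.+1) (potential mu j.+1 eta - potential mu j eta) * (h j.+1 - h j).
Proof.
move=> h0 hN.
rewrite (summation_by_parts h (fun k => potential mu k eta)) h0 hN !mul0r addr0 subr0.
by apply: eq_big_nat => k kn; rewrite potential_laplacian.
Qed.

(** The function h is the i-th row of the Green function corrected by the Poisson
    solution u of the reservoir, so that - L h = eta_i - rho_i. The Dirichlet
    identity bounds E [h (eta_i - rho_i)]; replacing h by W_i costs the
    oscillation of u, which is of the same order n. *)
Lemma potential_variance : exists2 K : R, 0 <= K &
  forall (beta : R) (n i : nat) (mu : {ffun Omega n.+1 -> R}),
  0 < beta < 1 -> (p < n)%N -> (0 < i <= n)%N -> stationary c beta mu ->
  expect mu (fun eta => potential mu i eta * centered mu i eta) <= K * n.+1%:R.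
Proof.
have [K K0 bound] := poisson_bound p_gt0 c_ge0 small.
pose C := K * \sum_(xi : config p) `|reservoir c xi| *+ 2.
have C0 : 0 <= C by rewrite mulr_ge0 //; apply: sumr_ge0 => xi _; rewrite mulrn_wge0.
pose S := \sum_xi c xi; have S0 : 0 <= S by exact: sumr_ge0.
pose a : R := 1 + C *+ 2.
have a0 : 0 <= a by rewrite addr_ge0 // mulrn_wge0.
exists ((S + 1) * a ^+ 2 + C) => [|beta n i mu b01 pn iN st].
  by rewrite addr_ge0 // mulr_ge0 ?sqr_ge0 // addr_ge0.
have d : is_distr mu by case: st.
have [u ub] := poisson_exists p_gt0 c_ge0 small
  (fun eta : config n => reservoir c (window p eta)) b01 pn st.
set e := expect mu _ in ub.
have n0 : (0 < n)%N by exact: leq_ltn_trans pn.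
have uC k : (0 < k <= n)%N -> infl u k <= C.
  move=> kn; have := bound (reservoir c) beta n u e b01 pn ub k kn.
  have : 0 <= k%:R * infl u n by rewrite mulr_ge0 ?infl_ge0.
  rewrite -/C; lra.
pose o : config n := [ffun=> false].
pose G k := green R n.+1 i k.
have iN1 : (i <= n.+1)%N by lia.
have G1 : 0 <= G 1%N <= 1.
  rewrite /G green1; last lia.
  by have := ratio_le1 R (ltn0Sn n) iN1; set x := (_ / _ : R); lra.
have Gs k : `|G k.+1 - G k| <= 1 by exact: green_slope.
have G0 : G 0%N = 0 by exact: green0.
have GN : G n.+1 = 0 by exact: greenN.
pose f (eta : config n) := \sum_(1 <= k < n.+1) G k * (occ eta k)%:R.
pose h (eta : config n) := f eta + G 1%N * u eta.
have gh (eta : config n) : - gen c beta (N := n.+1) h eta = centered mu i eta.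
  rewrite genD genZ /f (gen_green _ p_gt0 _ _ (ltnW pn) iN) /centered /density.
  rewrite (stationary_density p_gt0 (ltnW pn) iN st) -/e -/(G 1%N).
  have -> : gen c beta (N := n.+1) u eta = - (reservoir c (window p eta) - e).
    by rewrite -ub opprK.
  by rewrite -(@green1 R n.+1) -/(G 1%N); [ring|lia].
have flipf k eta : (0 < k <= n)%N -> `|f (flip k eta) - f eta| = `|G k|.
  move=> kn; rewrite -sumrB (bigD1_seq k) ?mem_index_iota ?iota_uniq //=.
  rewrite occ_flip // eqxx -big_filter big_seq big1 => [|j].
    by rewrite addr0; case: (occ eta k) => /=; rewrite ?mulr0 ?mulr1 ?sub0r ?subr0 ?normrN.
  rewrite mem_filter mem_index_iota => /andP[jk jn].
  by rewrite occ_flip // (negbTE jk) subrr.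
have exchf j eta : (0 < j < n)%N -> `|f (exch j eta) - f eta| <= 1.
  move=> jn; rewrite -sumrB.
  under eq_bigr do rewrite -mulrBr.
  rewrite (_ : \sum_(1 <= k < n.+1) G k * _ = \sum_(1 <= k < n.+1) G k *
    \sum_(j <= l < j.+1) ((occ eta (bond_swap l k))%:R - (occ eta k)%:R)); last first.
    by apply: eq_big_nat => k kn; rewrite big_nat1 occ_exch_swap.
  under eq_bigr do rewrite big_nat1.
  rewrite (bigD1_seq j) ?mem_index_iota ?iota_uniq //=; last lia.
  rewrite -big_filter (bigD1_seq j.+1) ?filter_uniq ?iota_uniq //=; last first.
    by rewrite mem_filter mem_index_iota; lia.
  rewrite big_seq_cond big1 => [|k]; last first.
    rewrite mem_filter => /andP[/andP[k1 _] k2].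
    by rewrite /bond_swap (negbTE k1) (negbTE k2) subrr mulr0.
  rewrite /bond_swap !eqxx gtn_eqF //.
  have := Gs j; rewrite !ler_norml.
  by case: (occ eta j); case: (occ eta j.+1) => /=; lra.
have Gu x C' : `|x| <= C' -> C' <= C *+ 2 -> `|G 1%N * x| <= C *+ 2.
  move=> xC C'C; rewrite normrM ger0_norm; last by case/andP: G1.
  rewrite -[leRHS]mul1r ler_pM //; [by case/andP: G1|by case/andP: G1|exact: le_trans C'C].
have hdiff eta zeta C' : `|f zeta - f eta| <= 1 -> `|u zeta - u eta| <= C' ->
    C' <= C *+ 2 -> `|h zeta - h eta| <= a.
  move=> h1 h2 h3; have := Gu _ _ h2 h3; move: h1; rewrite /h /a !ler_norml; lra.
have gam eta : carre_du_champ c beta h eta <= (S + n%:R) * a ^+ 2.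
  have n1 : (0 < 1 <= n)%N by [].
  have nn : (0 < n <= n)%N by rewrite n0 leqnn.
  apply: carre_du_champ_le => // [||j jn].
  - apply: hdiff (infl_norm u 1 eta) _; last by have := uC _ n1; lra.
    by rewrite flipf //; have := Gs 0%N; rewrite G0 subr0.
  - apply: hdiff (infl_norm u n eta) _; last by have := uC _ nn; lra.
    by rewrite flipf //; have := Gs n; rewrite GN sub0r normrN.
  - apply: hdiff (infl_exch u eta jn) _; first exact: exchf.
    case/andP: jn => j0 jn.
    have j1 : (0 < j <= n)%N by rewrite j0 ltnW.
    have j2 : (0 < j.+1 <= n)%N by [].
    have := uC _ j1; have := uC _ j2; lra.
have hE : expect mu (fun eta => h eta * centered mu i eta) *+ 2 <= (S + n%:R) * a ^+ 2.
  rewrite -(@eq_expect _ _ _ (fun eta : config n => h eta * - gen c beta (N := n.+1) h eta)).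
    by rewrite dirichlet_identity // -(expect_cst d (_ * _)); apply: le_expect.
  by move=> eta; rewrite gh.
pose K1 := - \sum_(1 <= k < n.+1) G k * density mu k - G 1%N * u o.
have uo (eta : config n) : `|u eta - u o| <= C * n%:R.
  apply: le_trans (oscillation u eta o) _.
  apply: le_trans (_ : \sum_(1 <= k < n.+1) C <= _).
    by apply: ler_sum_nat => k kn; exact: uC.
  by rewrite sumr_const_nat subSS subn0 mulr_natr.
(* W_i is h minus the oscillating part of its correction, plus the constant K1,
   whose product with the centred occupation has mean 0. *)
pose r (eta : config n) := - G 1%N * (u eta - u o) * centered mu i eta.
have rE : expect mu r <= C * n%:R.
  apply: le_trans (ler_norm _) _; apply: norm_expect_le => // eta.
  rewrite /r normrM normrM normrN -[leRHS]mulr1 ler_pM ?centered_le1 ?mulr_ge0 //.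
  rewrite -[leRHS]mul1r ler_pM ?normr_ge0 // ger0_norm; by case/andP: G1.
rewrite (@eq_expect _ _ _ _ (fun eta => h eta * centered mu i eta +
  (r eta + K1 * centered mu i eta))) => [|eta]; last first.
  rewrite /r /K1 /h /potential /f -/G.
  have -> : \sum_(1 <= j < n.+1) green R n.+1 i j * centered mu j eta
      = \sum_(1 <= k < n.+1) G k * (occ eta k)%:R - \sum_(1 <= k < n.+1) G k * density mu k.
    by rewrite -sumrB; apply: eq_bigr => k _; rewrite -mulrBr.
  by ring.
rewrite expectD (expectD _ r) expectZ expect_centered // mulr0 addr0.
have nN : n.+1%:R = n%:R + 1 :> R by rewrite natr1.
have n1 : 0 <= n%:R :> R by [].
have q0 : 0 <= a ^+ 2 by rewrite sqr_ge0.
have e1 : 0 <= S * a ^+ 2 by rewrite mulr_ge0.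
have e2 : 0 <= S * a ^+ 2 * n%:R by rewrite mulr_ge0.
have e3 : 0 <= a ^+ 2 * n%:R by rewrite mulr_ge0.
rewrite nN; lra.
Qed.

Lemma field_energy : exists2 K : R, 0 <= K &
  forall (beta : R) (n : nat) (mu : {ffun Omega n.+1 -> R}),
  0 < beta < 1 -> (p < n)%N -> stationary c beta mu ->
  expect mu (fun eta =>
    \sum_(0 <= j < n.+1) (potential mu j.+1 eta - potential mu j eta) ^+ 2)
  <= K * n.+1%:R ^+ 2.
Proof.
have [K K0 bound] := potential_variance; exists K => // beta n mu b01 pn st.
rewrite (@eq_expect _ _ _ _ (fun eta =>
  \sum_(1 <= k < n.+1) potential mu k eta * centered mu k eta)) => [|eta]; last first.
  by rewrite pairing_potential ?potential0 ?potentialN //; apply: eq_bigr => j _; rewrite expr2.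
rewrite expect_sum; apply: le_trans (_ : \sum_(1 <= k < n.+1) K * n.+1%:R <= _).
  by apply: ler_sum_nat => k kn; apply: bound b01 pn kn st.
rewrite sumr_const_nat subSS subn0 -(mulr_natr (K * _)) expr2 mulrA ler_wpM2l ?mulr_ge0 //.
by rewrite ler_nat.
Qed.

(** The product of increments is split by the inequality 2 |x| q <= x^2 + q^2. The
    parameter q is left free: with q of order N times a small number, both terms
    are small relative to N when the increments of h are of order 1/N. *)
Lemma smooth_field_bound : exists2 K : R, 0 <= K &
  forall (beta : R) (n : nat) (mu : {ffun Omega n.+1 -> R}) (h : nat -> R) (l q : R),
  0 < beta < 1 -> (p < n)%N -> stationary c beta mu -> 0 < q ->
  h 0%N = 0 -> h n.+1 = 0 ->
  (forall k, (k <= n)%N -> `|h k.+1 - h k| <= l) ->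
  expect mu (fun eta => `|\sum_(1 <= k < n.+1) h k * centered mu k eta|)
  <= l * (K * n.+1%:R ^+ 2 / (2 * q) + n.+1%:R * q / 2).
Proof.
have [K K0 energy] := field_energy; exists K => // beta n mu h l q b01 pn st q0 h0 hN hl.
have d : is_distr mu by case: st.
have l0 : 0 <= l by apply: le_trans (hl 0%N _).
pose D eta := \sum_(0 <= j < n.+1) (potential mu j.+1 eta - potential mu j eta) ^+ 2.
apply: le_trans (_ : expect mu (fun eta => l * (D eta / (2 * q) + n.+1%:R * q / 2)) <= _).
  apply: le_expect => // eta; rewrite pairing_potential //.
  apply: le_trans (ler_norm_sum _ _ _) _.
  apply: le_trans (_ : \sum_(0 <= j < n.+1)
     l * ((potential mu j.+1 eta - potential mu j eta) ^+ 2 / (2 * q) + q / 2) <= _).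
    apply: ler_sum_nat => j jn; rewrite normrM mulrC ler_pM ?normr_ge0 ?hl //.
    set x := potential mu j.+1 eta - _.
    have -> : x ^+ 2 / (2 * q) + q / 2 = (`|x| ^+ 2 + q ^+ 2) / (2 * q).
      by rewrite real_normK ?num_real //; field; rewrite gt_eqF.
    rewrite ler_pdivlMr ?mulr_gt0 //; have := sqr_ge0 (`|x| - q); rewrite sqrrB; lra.
  rewrite -mulr_sumr ler_wpM2l // big_split /= -mulr_suml lerD2l.
  by rewrite sumr_const_nat subn0 -mulrA mulr_natl.
rewrite expectZ ler_wpM2l // expectD expect_cst // lerD2r.
rewrite (@eq_expect _ _ _ _ (fun eta => (2 * q)^-1 * D eta)) => [|eta]; last exact: mulrC.
rewrite expectZ mulrC ler_pM2r ?invr_gt0 ?mulr_gt0 //.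
exact: energy b01 pn st.
Qed.

End Fluctuations.

(** * Lipschitz approximation on a grid *)

Lemma count_below (R : realType) (x : R) (m : nat) : 0 <= x ->
  \sum_(1 <= k < m.+1) (k%:R < x)%R%:R <= x.
Proof.
move=> x0; suff [] : \sum_(1 <= k < m.+1) (k%:R < x)%R%:R <= x /\
    \sum_(1 <= k < m.+1) (k%:R < x)%R%:R <= m%:R :> R by [].
elim: m => [|m [IH1 IH2]]; first by rewrite big_geq.
rewrite big_nat_recr //= -natr1.
by case: ltrP => [mx|mx] /=; rewrite ?addr0; split; move: mx; rewrite -?natr1; lra.
Qed.

(** The inf-convolution of F, set to 0 at both ends, with a cone of slope
    M / delta. The value at a far grid point is raised by at least M, so that
    only points within delta matter; F varies by at most eps there, unless an
    end of the grid is that close, which happens for a proportion at most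
    2 delta of the points. *)
Lemma grid_lipschitz_minorant (R : realType) (N : nat) (F : nat -> R) (M delta eps : R) :
  (0 < N)%N -> 0 < delta -> 0 <= eps ->
  (forall j, (0 < j < N)%N -> 0 <= F j <= M) ->
  (forall j k, (0 < j < N)%N -> (0 < k < N)%N ->
     `|k%:R - j%:R| < delta * N%:R :> R -> F k - F j <= eps) -> 0 <= M ->
  exists h : nat -> R, [/\ h 0%N = 0, h N = 0,
    forall k, (k < N)%N -> `|h k.+1 - h k| <= M / delta / N%:R &
    \sum_(1 <= k < N) `|F k - h k| <= N%:R * (eps + 2 * M * delta)].
Proof.
move=> N0 delta0 eps0 FM Feps M0.
have NR : 0 < N%:R :> R by rewrite ltr0n.
pose L := M / delta / N%:R.
have L0 : 0 <= L by rewrite !divr_ge0 // ltW.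
(* The base value of the minimum below is its term j = 0. *)
pose F' j := if (0 < j < N)%N then F j else 0.
have F'0 j : 0 <= F' j by rewrite /F'; case: ifP => // jN; case/andP: (FM j jN).
pose h k := \big[Num.min/(L * k%:R)]_(j < N.+1) (F' j + L * `|k%:R - j%:R|).
have hle k (j : nat) : (j <= N)%N -> h k <= F' j + L * `|k%:R - j%:R|.
  by move=> jN; exact: (bigmin_le _ (Ordinal (jN : (j < N.+1)%N))).
have hge k (x : R) : (forall j, (j <= N)%N -> x <= F' j + L * `|k%:R - j%:R|) -> x <= h k.
  move=> H; apply: le_bigmin => [|j _]; last by apply: H; rewrite -ltnS.
  by have := H 0%N (leq0n N); rewrite /F' /= subr0 add0r ger0_norm.
have h_ge0 k : 0 <= h k.
  by apply: hge => j _; rewrite addr_ge0 // mulr_ge0.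
have lip k m : `|k%:R - m%:R| <= 1 :> R -> h k <= h m + L.
  move=> km; rewrite -lerBlDr; apply: hge => j jN.
  have := hle k j jN; have : L * `|k%:R - j%:R| <= L * (`|m%:R - j%:R| + 1).
    rewrite ler_wpM2l //; have := ler_distD (m%:R) k%:R (j%:R : R); lra.
  lra.
exists h; split.
- apply/eqP; rewrite eq_le h_ge0 andbT.
  by have := hle 0%N 0%N (leq0n N); rewrite /F' /= subrr normr0 mulr0 addr0.
- apply/eqP; rewrite eq_le h_ge0 andbT.
  by have := hle N N (leqnn N); rewrite /F' ltnn andbF subrr normr0 mulr0 addr0.
- move=> k kN; have h1 : `|k.+1%:R - k%:R| <= 1 :> R by rewrite -natrB // subSnn normr1.
  have h2 : `|k%:R - k.+1%:R| <= 1 :> R by rewrite distrC.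
  by have := lip _ _ h1; have := lip _ _ h2; rewrite -/L ler_norml; lra.
have dN : 0 <= delta * N%:R by rewrite mulr_ge0 // ltW.
have pt k : (1 <= k < N)%N -> `|F k - h k| <=
    eps + M * (k%:R < delta * N%:R)%R%:R + M * ((N - k)%:R < delta * N%:R)%R%:R.
  move=> kN; have Fk : F' k = F k by rewrite /F' kN.
  have kN' : (k <= N)%N by case/andP: kN => _ /ltnW.
  have hF : h k <= F k.
    by have := hle k k kN'; rewrite subrr normr0 mulr0 addr0 Fk.
  rewrite ger0_norm ?subr_ge0 //.
  have /andP[Fk0 FkM] := FM k kN; have hk0 := h_ge0 k.
  have [k1|k1] /= := ltrP k%:R (delta * N%:R).
    rewrite mulr1; have := mulr_ge0 M0 (ler0n R ((N - k)%:R < delta * N%:R)%R); lra.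
  have [k2|k2] /= := ltrP (N - k)%:R (delta * N%:R); first by rewrite mulr1; lra.
  rewrite !mulr0 !addr0 lerBlDr -lerBlDl; apply: hge => j jN.
  have [near|far] := ltrP `|k%:R - j%:R| (delta * N%:R).
    (* An end of the grid cannot be this near to k. *)
    have jin : (0 < j < N)%N.
      apply/andP; split.
        rewrite lt0n; apply: contraTneq near => ->.
        by rewrite subr0 ger0_norm // -leNgt.
      rewrite ltn_neqAle jN andbT; apply: contraTneq near => ->.
      by rewrite distrC -natrB // ger0_norm // -leNgt.
    have := Feps j k jin kN near; rewrite {1}/F' jin.
    have := mulr_ge0 L0 (normr_ge0 (k%:R - j%:R)); lra.
  have : L * (delta * N%:R) <= L * `|k%:R - j%:R| by rewrite ler_wpM2l.
  have -> : L * (delta * N%:R) = M by rewrite /L; field; rewrite !gt_eqF.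
  have := F'0 j; lra.
apply: le_trans (ler_sum_nat pt) _.
rewrite !big_split /= -!mulr_sumr sumr_const_nat.
have c1 : \sum_(1 <= k < N) (k%:R < delta * N%:R)%R%:R <= delta * N%:R.
  by rewrite -(prednK N0) count_below // prednK.
have c2 : \sum_(1 <= k < N) ((N - k)%:R < delta * N%:R)%R%:R <= delta * N%:R.
  rewrite big_nat_rev /=; apply: le_trans c1; apply: ler_sum_nat => k kN.
  by rewrite add1n subSS subKn //; case/andP: kN => _ /ltnW.
have e1 : eps *+ (N - 1) <= eps * N%:R.
  by rewrite -[leLHS]mulr_natr ler_wpM2l // ler_nat leq_subr.
have := ler_wpM2l M0 c1; have := ler_wpM2l M0 c2; lra.
Qed.

(** Heine's theorem, by compactness of the segment in its near-covering form. *)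
Lemma segment_unif_continuous (R : realType) (G : R -> R) (a b : R) :
  {within `[a, b], continuous G} -> forall eps, 0 < eps ->
  exists2 delta, 0 < delta & forall x y, a <= x <= b -> a <= y <= b ->
    `|x - y| < delta -> `|G x - G y| <= eps.
Proof.
move=> cG eps eps0.
have /compact_near_coveringP/near_covering_withinP cov := @segment_compact R a b.
pose P (d x : R) := forall y, a <= y <= b -> `|x - y| < d -> `|G x - G y| <= eps.
have := cov R (0 : R)^'+ P _.
case=> [x xab|d /= d0 H].
  have := (subspace_continuousP `[a, b]%classic G).1 cG x xab.
  move=> /cvgrPdist_lt /(_ (eps / 2)) []; first by rewrite divr_gt0.
  move=> r /= r0 hr.
  exists (ball x (r / 2), [set d : R | 0 < d < r / 2]) => /=.
    split; first by apply: nbhsx_ballx; rewrite divr_gt0.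
    exists (r / 2) => /=; first by rewrite divr_gt0.
    move=> d /=; rewrite sub0r normrN => dr d0.
    by rewrite d0 -(gtr0_norm d0).
  move=> [x' d] /= [xx' /andP[d0 dr]] x'ab y yab x'y.
  have hx' : `|G x - G x'| < eps / 2.
    by apply: hr => //=; move: xx'; rewrite /ball /=; lra.
  have hy : `|G x - G y| < eps / 2.
    apply: hr => //=; move: xx'; rewrite /ball /=.
    by have := ler_distD x' x y; lra.
  by have := ler_distD (G x) (G x') (G y); rewrite (distrC (G x') (G x)); lra.
exists (d / 2); first by rewrite divr_gt0.
move=> x y xab yab xy.
have dd : 0 < d / 2 by rewrite divr_gt0.
apply: (H (d / 2) _ dd x _ y yab xy); last by rewrite /= in_itv.
by rewrite /= sub0r normrN gtr0_norm //; lra.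
Qed.

Lemma segment_bounded (R : realType) (G : R -> R) (a b : R) :
  {within `[a, b], continuous G} ->
  exists2 M, 0 <= M & forall x, a <= x <= b -> `|G x| <= M.
Proof.
move=> cG; have [ab|ba] := lerP a b; last first.
  by exists 0 => // x /andP[ax xb]; have := le_trans ax xb; lra.
have [x1 _ h1] := EVT_max ab cG; have [x2 _ h2] := EVT_min ab cG.
exists (`|G x1| + `|G x2|) => [|x xab]; first by rewrite addr_ge0.
have xin : x \in `[a, b] by rewrite in_itv.
have := h1 _ xin; have := h2 _ xin; have := ler_norm (G x1).
have := ler_norm (- G x2); rewrite normrN ler_norml => g1 g2 g3 g4.
have := normr_ge0 (G x1); have := normr_ge0 (G x2); lra.
Qed.

(** The minorant is built for nonnegative functions, and is applied to G + M and to
    the constant M. *)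
Lemma grid_lipschitz_approximation (R : realType) (G : R -> R) (eps : R) :
  {within `[0, 1], continuous G} -> 0 < eps ->
  exists2 L : R, 0 <= L & forall N, (0 < N)%N ->
  exists h : nat -> R, [/\ h 0%N = 0, h N = 0,
    forall k, (k < N)%N -> `|h k.+1 - h k| <= L / N%:R &
    \sum_(1 <= k < N) `|G (k%:R / N%:R) - h k| <= N%:R * eps].
Proof.
move=> cG eps0; have [M M0 GM] := segment_bounded cG.
have e3 : 0 < eps / 3 by rewrite divr_gt0.
have [d1 d10 Gd1] := segment_unif_continuous cG e3.
pose d := Num.min d1 (eps / (9 * (M + 1))).
have d0 : 0 < d by rewrite lt_min d10 divr_gt0 // mulr_gt0 //; lra.
have dM : d * (M + 1) <= eps / 9.
  rewrite -ler_pdivlMr; last lra.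
  apply: le_trans (_ : eps / (9 * (M + 1)) <= _); first by rewrite ge_min lexx orbT.
  by rewrite invfM mulrA.
have M2 : 0 <= M *+ 2 by rewrite mulrn_wge0.
exists (M * 3 / d) => [|N N0]; first by rewrite divr_ge0 ?mulr_ge0 // ltW.
have NR : 0 < N%:R :> R by rewrite ltr0n.
have grid k : (0 < k < N)%N -> 0 <= (k%:R / N%:R : R) <= 1.
  case/andP=> _ /ltnW kN.
  by rewrite divr_ge0 // ler_pdivrMr // mul1r ler_nat.
have [||||h1 [h10 h1N h1L h1S]] := @grid_lipschitz_minorant R N
    (fun k => G (k%:R / N%:R) + M) (M *+ 2) d (eps / 3) N0 d0.
- exact: ltW.
- by move=> j /grid/GM; rewrite ler_norml; lra.
- move=> j k jN kN jk; have := Gd1 _ _ (grid k kN) (grid j jN).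
  rewrite -mulrBl normrM normfV (gtr0_norm NR) ltr_pdivrMr //.
  have : `|k%:R - j%:R| < d1 * N%:R.
    by apply: lt_le_trans jk _; rewrite ler_wpM2r ?ge_min ?lexx // ltW.
  by move=> h /(_ h); rewrite ler_norml; lra.
- exact: M2.
have [||||h2 [h20 h2N h2L h2S]] := @grid_lipschitz_minorant R N
    (fun k => M) M d 0 N0 d0.
- by [].
- by move=> j _; rewrite M0 lexx.
- by move=> j k _ _ _; rewrite subrr.
- exact: M0.
exists (fun k => h1 k - h2 k); split.
- by rewrite h10 h20 subrr.
- by rewrite h1N h2N subrr.
- move=> k kN; have := h1L k kN; have := h2L k kN.
  have -> : M * 3 / d / N%:R = M *+ 2 / d / N%:R + M / d / N%:R by ring.
  by rewrite !ler_norml; lra.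
apply: le_trans (_ : \sum_(1 <= k < N) (`|G (k%:R / N%:R) + M - h1 k| + `|M - h2 k|) <= _).
  apply: ler_sum_nat => k kN.
  rewrite (_ : G _ - _ = (G (k%:R / N%:R) + M - h1 k) - (M - h2 k)); last by ring.
  exact: ler_normB.
rewrite big_split /=; apply: le_trans (lerD h1S h2S) _.
rewrite -mulrDr ler_wpM2l ?ltW //; lra.
Qed.

(** * The Laplace equation on the unit interval *)

(** By the mean value theorem the slopes of u on [0, x] and [x, 1] are values of
    u', and u' is constant by the mean value theorem again. *)
Lemma laplace_solution_affine (R : realType) (a b : R) (u : R -> R) :
  laplace_solution a b u -> forall x, 0 <= x <= 1 -> u x = a + (b - a) * x.
Proof.
case=> cu du ddu u0 u1 x /andP[x0 x1].
have [->|xn0] := eqVneq x 0; first by rewrite u0 mulr0 addr0.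
have [->|xn1] := eqVneq x 1; first by rewrite u1; ring.
have {}x0 : 0 < x by rewrite lt_neqAle eq_sym xn0.
have {}x1 : x < 1 by rewrite lt_neqAle xn1.
have mvt s t : 0 <= s -> s < t -> t <= 1 ->
    exists2 z, s < z < t & u t - u s = derive1 u z * (t - s).
  move=> s0 st t1; have [z||z zst e] := @MVT R u (derive1 u) s t st.
  - rewrite in_itv /= => /andP[sz zt]; rewrite derive1E; apply: DeriveDef => //.
    by apply: du; apply/andP; split; lra.
  - apply: continuous_subspaceW cu => z /=; rewrite !in_itv /= => /andP[sz zt].
    by apply/andP; split; lra.
  by exists z => //; move: zst; rewrite in_itv.
have [y1 /andP[y10 y1x] e1] := mvt 0 x (lexx _) x0 (ltW x1).
have [y2 /andP[xy2 y21] e2] := mvt x 1 (ltW x0) x1 (lexx _).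
have y12 : y1 < y2 by lra.
have dcst : derive1 u y2 - derive1 u y1 = 0.
  have inI z : y1 <= z <= y2 -> 0 < z < 1 by move=> /andP[h1 h2]; apply/andP; split; lra.
  have [z||z zst e] := @MVT R (derive1 u) (derive1 (derive1 u)) y1 y2 y12.
  - rewrite in_itv /= => /andP[sz zt]; rewrite derive1E; apply: DeriveDef => //.
    by case: (ddu z _) => //; apply: inI; rewrite !ltW.
  - apply: derivable_within_continuous => z; rewrite in_itv /= => zI.
    by case: (ddu z _) => //; exact: inI.
  rewrite e; move: zst; rewrite in_itv /= => /andP[h1 h2].
  have [_] : derivable (derive1 u) z 1 /\ derive1n 2 u z = 0.
    by apply: ddu; apply: inI; rewrite !ltW.
  by rewrite /derive1n /= => ->; rewrite mul0r.
have dy : derive1 u y2 = derive1 u y1 by lra.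
move: e1 e2; rewrite dy u0 u1 subr0 => e1 e2.
have e3 : b - a = derive1 u y1 by lra.
by rewrite e3; lra.
Qed.

Lemma affine_laplace_solution (R : realType) (a b : R) :
  laplace_solution a b (fun x => a + (b - a) * x).
Proof.
have d1 (x : R) : is_derive x 1 (fun x : R => a + (b - a) * x) (b - a).
  have := is_deriveD (is_derive_cst a x 1) (is_deriveZ (b - a) (is_derive_id x 1)).
  by rewrite add0r /GRing.scale /= mulr1.
have d1E : derive1 (fun x : R => a + (b - a) * x) = cst (b - a).
  by apply/funext => x; rewrite derive1E; exact: derive_val.
split=> [|x _|x _||].
- by apply: derivable_within_continuous => x _; exact: ex_derive.
- exact: ex_derive.
- rewrite /derive1n /= d1E; split; first exact: derivable_cst.
  by rewrite derive1_cst.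
- by rewrite mulr0 addr0.
- by rewrite mulr1 addrC subrK.
Qed.

(** * Limits *)

Lemma eventually_ratio (R : realType) (K eps : R) (q : nat) : 0 < eps ->
  \forall N \near \oo, exists n, [/\ N = n.+1, (q < n)%N & K / n%:R <= eps].
Proof.
move=> eps0; pose T := Num.truncn (`|K| / eps).
exists (q + T).+3%N => // -[|n] //= qn; exists n; split => //; first by lia.
have n0 : 0 < n%:R :> R by rewrite ltr0n; lia.
rewrite ler_pdivrMr // mulrC -ler_pdivrMr //.
apply: le_trans (_ : `|K| / eps <= _); first by rewrite ler_pM2r ?invr_gt0 // ler_norm.
apply: le_trans (ltW (truncnS_gt _)) _; rewrite ler_nat -/T; lia.
Qed.
Section Conclusion.
Variables (R : realType) (p : nat) (c : config p -> R).
Hypotheses (p_gt0 : (0 < p)%N) (c_ge0 : forall xi, 0 <= c xi).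
Hypothesis small :
  (p - 1)%:R * total_lambda c < min_rate c false + min_rate c true.

(** The lower bounds E b - C / n never exceed the upper bounds E b + C / n, taken
    over all lengths and all beta, so that their supremum is within C / n of
    every E b. *)
Lemma reservoir_limit : exists alpha C : R, 0 <= C /\
  forall (beta : R) (n : nat) (mu : {ffun Omega n.+1 -> R}),
  0 < beta < 1 -> (p < n)%N -> stationary c beta mu ->
  `|expect mu (fun eta : config n => reservoir c (window p eta)) - alpha| <= C / n%:R.
Proof.
have [C C0 cmp] := local_mean_compare p_gt0 c_ge0 small (reservoir c).
pose m n (mu : {ffun Omega n.+1 -> R}) :=
  expect mu (fun eta : config n => reservoir c (window p eta)).
pose S := [set x | exists beta n (mu : {ffun Omega n.+1 -> R}),
  [/\ 0 < beta < 1, (p < n)%N, stationary c beta mu & x = m n mu - C / n%:R]].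
have cross (beta beta' : R) n n' (mu : {ffun Omega n.+1 -> R}) (mu' : {ffun Omega n'.+1 -> R}) :
    0 < beta < 1 -> 0 < beta' < 1 -> (p < n)%N -> (p < n')%N ->
    stationary c beta mu -> stationary c beta' mu' ->
    m n mu - C / n%:R <= m n' mu' + C / n'%:R.
  move=> b b' pn pn' st st'.
  have Cn k : 0 <= C / k%:R by rewrite divr_ge0.
  have := Cn n; have := Cn n'; have [nn'|n'n] := leqP n n'.
    have := cmp _ _ _ _ _ _ b b' pn nn' st st'.
    by rewrite ler_norml -/(m _ _) -/(m n' _); lra.
  have := cmp _ _ _ _ _ _ b' b pn' (ltnW n'n) st' st.
  by rewrite ler_norml -/(m _ _) -/(m n _); lra.
exists (sup S), C; split => // beta n mu b pn st; rewrite -/(m n mu).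
have Sub : ubound S (m n mu + C / n%:R).
  by move=> x [beta' [n' [mu' [b' pn' st' ->]]]]; apply: cross b' b pn' pn st' st.
have Sin : S (m n mu - C / n%:R) by exists beta, n, mu.
have up : sup S <= m n mu + C / n%:R by apply: ge_sup => //; exists (m n mu - C / n%:R).
have lo : m n mu - C / n%:R <= sup S by apply: ub_le_sup => //; exists (m n mu + C / n%:R).
by rewrite ler_norml; lra.
Qed.

Lemma density_profile : exists alpha C : R, 0 <= C /\
  forall (beta : R) (n k : nat) (mu : {ffun Omega n.+1 -> R}),
  0 < beta < 1 -> (p < n)%N -> (0 < k <= n)%N -> stationary c beta mu ->
  `|density mu k - (alpha + (beta - alpha) * (k%:R / n.+1%:R))| <= C / n%:R.
Proof.
have [alpha [C [C0 lim]]] := reservoir_limit.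
exists alpha, C; split => // beta n k mu b pn kn st.
rewrite /density (stationary_density p_gt0 (ltnW pn) kn st).
have := lim beta n mu b pn st; set A := expect mu _; set x := k%:R / _ => h.
have -> : (1 - x) * A + x * beta - (alpha + (beta - alpha) * x) = (1 - x) * (A - alpha).
  by ring.
have /andP[x0 x1] : 0 <= x <= 1 by apply: ratio_le1; case/andP: kn => _ /leqW.
rewrite normrM -[leRHS]mul1r ler_pM // ger0_norm; lra.
Qed.

(** The field is split into the field tested against h, the error of replacing G
    by h, where the centred occupation is at most 1, and the error of the
    density profile. *)
Lemma empirical_gap_le (n : nat) (mu : {ffun Omega n.+1 -> R}) (G u : R -> R)
    (h : nat -> R) (eta : config n) : is_distr mu ->
  `|empirical_gap G u (N := n.+1) eta| <= n.+1%:R^-1 *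
    (`|\sum_(1 <= k < n.+1) h k * centered mu k eta|
     + (\sum_(1 <= k < n.+1) `|G (k%:R / n.+1%:R) - h k|
        + \sum_(1 <= k < n.+1) `|G (k%:R / n.+1%:R)|
            * `|density mu k - u (k%:R / n.+1%:R)|)).
Proof.
move=> d; rewrite /empirical_gap normrM ger0_norm ?invr_ge0 // ler_wpM2l ?invr_ge0 //.
rewrite (eq_bigr (fun k => h k * centered mu k eta
   + ((G (k%:R / n.+1%:R) - h k) * centered mu k eta
   + G (k%:R / n.+1%:R) * (density mu k - u (k%:R / n.+1%:R))))) => [|k _]; last first.
  by rewrite /centered; ring.
rewrite !big_split /=.
apply: le_trans (ler_normD _ _) _; rewrite lerD2l.
apply: le_trans (ler_normD _ _) _; apply: lerD; apply: le_trans (ler_norm_sum _ _ _) _.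
  by apply: ler_sum => k _; rewrite normrM -[leRHS]mulr1 ler_pM // centered_le1.
by apply: ler_sum => k _; rewrite normrM.
Qed.

Lemma law_of_large_numbers (G u : R -> R) (C : R) :
  {within `[0, 1], continuous G} -> 0 <= C -> forall eps, 0 < eps ->
  exists K : R, forall (beta : R) (n : nat) (mu : {ffun Omega n.+1 -> R}),
  0 < beta < 1 -> (p < n)%N -> stationary c beta mu ->
  (forall k, (0 < k <= n)%N -> `|density mu k - u (k%:R / n.+1%:R)| <= C / n%:R) ->
  expect mu (fun eta => `|empirical_gap G u (N := n.+1) eta|) <= eps + K / n%:R.
Proof.
move=> cG C0 eps eps0; have [K K0 smooth] := smooth_field_bound p_gt0 c_ge0 small.
have [M M0 GM] := segment_bounded cG.
have e2 : 0 < eps / 2 by rewrite divr_gt0.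
have [L L0 approx] := grid_lipschitz_approximation cG e2.
(* With q = t N, the first term of the bound is of order 1/N after division by N
   and the second one is at most L t / 2. *)
pose t := eps / (L + 1).
have L1 : 0 < L + 1 by lra.
have t0 : 0 < t by rewrite divr_gt0.
have Lt : L * t <= eps by rewrite /t mulrCA ger_pMr // ler_pdivrMr //; lra.
exists (L * K / (2 * t) + M * C) => beta n mu b pn st close.
have d : is_distr mu by case: st.
have n0 : 0 < n%:R :> R by rewrite ltr0n; exact: leq_ltn_trans pn.
have N0 : 0 < n.+1%:R :> R by rewrite ltr0n.
have [h [h0 hN hl hS]] := approx n.+1 (ltn0Sn n).
have tN : 0 < t * n.+1%:R by rewrite mulr_gt0.
have := smooth beta n mu h (L / n.+1%:R) (t * n.+1%:R) b pn st tN h0 hN (fun k kn => hl k kn).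
set E := expect mu _ => HE.
apply: le_trans (_ : expect mu (fun eta => n.+1%:R^-1 *
    (`|\sum_(1 <= k < n.+1) h k * centered mu k eta|
     + (n.+1%:R * (eps / 2) + n.+1%:R * (M * (C / n%:R))))) <= _).
  apply: le_expect => // eta; apply: le_trans (empirical_gap_le G u h eta d) _; rewrite ler_wpM2l ?invr_ge0 // lerD2l lerD //.
  apply: le_trans (_ : \sum_(1 <= k < n.+1) M * (C / n%:R) <= _).
    apply: ler_sum_nat => k kn; rewrite ler_pM ?close //; apply: GM.
    by apply: ratio_le1; case/andP: kn => _ /ltnW.
  rewrite sumr_const_nat subSS subn0 -[leLHS]mulr_natl ler_wpM2r ?ler_nat //.
  by rewrite mulr_ge0 // divr_ge0 // ltW.
rewrite expectZ expectD expect_cst // -/E.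
have : n.+1%:R^-1 * E <= n.+1%:R^-1 *
   (L / n.+1%:R * (K * n.+1%:R ^+ 2 / (2 * (t * n.+1%:R)) + n.+1%:R * (t * n.+1%:R) / 2)).
  by rewrite ler_wpM2l // invr_ge0 ltW.
have -> : n.+1%:R^-1 *
   (L / n.+1%:R * (K * n.+1%:R ^+ 2 / (2 * (t * n.+1%:R)) + n.+1%:R * (t * n.+1%:R) / 2))
   = L * K / (2 * t) / n.+1%:R + L * t / 2.
  by field; rewrite !gt_eqF.
have mono : L * K / (2 * t) / n.+1%:R <= L * K / (2 * t) / n%:R.
  apply: ler_wpM2l; last by rewrite lef_pV2 ?posrE // ler_nat.
  by apply: divr_ge0; apply: mulr_ge0 => //; exact: ltW.
move=> HE'; rewrite mulrDr.
have -> : n.+1%:R^-1 * (n.+1%:R * (eps / 2) + n.+1%:R * (M * (C / n%:R)))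
    = eps / 2 + M * C / n%:R by field; rewrite !gt_eqF.
rewrite [(_ + _) / n%:R]mulrDl.
move: HE' mono; set x1 := _^-1 * E; set x2 := L * K / _ / n.+1%:R.
by set x3 := L * K / _ / n%:R; set x4 := M * C / n%:R; lra.
Qed.

End Conclusion.

Theorem theorem2p4 (R : realType) (p : nat) (c : config p -> R)
    (p_gt0 : (0 < p)%N) (c_ge0 : forall xi, 0 <= c xi)
    (small : (p - 1)%:R * (\sum_(xi : Omega p) (lambda c false xi + lambda c true xi))
             < min_rate c false + min_rate c true) :
  exists alpha : R, forall beta : R, 0 < beta < 1 ->
    (fun N : nat => rho c beta N 1) @ \oo --> alpha /\
    exists ubar : R -> R,
      [/\ laplace_solution alpha beta ubar,
          forall u : R -> R, laplace_solution alpha beta u ->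
            forall x : R, 0 <= x <= 1 -> u x = ubar x
        & forall G : R -> R, {within `[0, 1], continuous G} ->
            (fun N : nat => expect (stat_state c beta N)
               (fun eta => `| empirical_gap G ubar eta |)) @ \oo --> (0 : R)].
Proof.
have [alpha [C [C0 prof]]] := density_profile p_gt0 c_ge0 small.
exists alpha => beta b.
have st N := stationary_stat_state N c_ge0 b.
split.
  apply/cvgrPdist_le => eps eps0.
  have := eventually_ratio (C + `|beta - alpha|) p eps0; apply: filterS => N [n [-> pn Kn]].
  have n1 : (0 < 1 <= n)%N by exact: leq_ltn_trans pn.
  rewrite distrC; apply: le_trans Kn.
  have h : `|rho c beta n.+1 1 - (alpha + (beta - alpha) * (1 / n.+1%:R))| <= C / n%:R.
    exact: (prof beta n 1%N _ b pn n1 (st n.+1)).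
  have h' : `|(beta - alpha) * (1 / n.+1%:R)| <= `|beta - alpha| / n%:R.
    rewrite normrM mul1r normfV (ger0_norm (ler0n _ n.+1)); apply: ler_wpM2l => //.
    by rewrite lef_pV2 ?posrE ?ltr0n // ler_nat.
  rewrite mulrDl; apply: le_trans (lerD h h').
  by apply: le_trans (ler_normD _ _); rewrite opprD addrA subrK.
exists (fun x => alpha + (beta - alpha) * x); split.
- exact: affine_laplace_solution.
- exact: laplace_solution_affine.
move=> G cG; apply/cvgrPdist_le => eps eps0.
have e2 : 0 < eps / 2 by rewrite divr_gt0.
have [K lln] := law_of_large_numbers p_gt0 c_ge0 small
  (fun x => alpha + (beta - alpha) * x) cG C0 e2.
have := eventually_ratio K p e2; apply: filterS => N [n [-> pn Kn]].
rewrite sub0r normrN ger0_norm; last first.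
  by apply: sumr_ge0 => eta _; rewrite mulr_ge0 //; case: (st n.+1) => -[].
apply: le_trans (lln beta n _ b pn (st n.+1) _) _; last lra.
by move=> k kn; exact: (prof beta n k _ b pn kn (st n.+1)).
Qed.
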